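(* Let $p(z)= z^{\ell} + b_{\ell-1} z^{\ell-1} + \dots + b_{1} z + b_{0}$ be a polynomial with complex coefficients, $\ell \geq 3$. Define $m = \lceil \ell/2 \rceil$, $n=2m$, and complex numbers $a_0,\dots,a_{n-1}$ by: if $\ell$ is even, $a_{j} = b_{j}$ for $j=0,\dots,n-1$; if $\ell$ is odd, $a_{0} = 0$ and $a_{j} = b_{j-1}$ for $j=1,\dots,n-1$. Define $$A_{0} = \begin{pmatrix} -a_0 & a_{n-1} a_0 \\ -a_1 & a_{n-1} a_1 - a_0 \end{pmatrix}, \qquad A_{j} = \begin{pmatrix} -a_{2j} & a_{n-1} a_{2j} -a_{2j-1} \\ -a_{2j+1} & a_{n-1}a_{2j+1} -a_{2j} \end{pmatrix} \quad (j=1,\dots,m-1),$$ and let $S$ be a nonsingular complex $2\times 2$ matrix such that $S^{-1}A_{m-1} S = \begin{pmatrix} \alpha & \gamma \\ 0 & \beta \end{pmatrix}$, where $\alpha, \beta, \gamma \in \mathbb{C}$. Define the vectors $v=(v_0,\dots,v_{n-3})$, $w=(w_0,\dots,w_{n-3}) \in \mathbb{C}^{n-2}$ by $$\begin{pmatrix} v_{2j} & w_{2j} \\ v_{2j+1} & w_{2j+1} \end{pmatrix} = S^{-1} A_j S \quad (j=0,\dots,m-2).$$ For $x>0$, let $$\rho_{1}(x) = \frac{|v_{n-3}|}{x} + \frac{|v_{n-4}|}{x^{2}} + \dots + \frac{|v_1|}{x^{n-3}} + \frac{|v_0|}{x^{n-2}},$$ $$\rho_{2}(x) = \frac{|\gamma|}{x}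 + \frac{|w_{n-3}|}{x^{2}} + \frac{|w_{n-4}|}{x^{3}} + \dots + \frac{|w_1|}{x^{n-2}} + \frac{|w_0|}{x^{n-1}},$$ $$\chi_{1}(x) = x^{n} - |\alpha|x^{n-2} + |v_{n-3}|x^{n-3} + \dots + |v_1| x + |v_0|,$$ $$\chi_{2}(x) = x^{n+1} - |\beta|x^{n-1} + |\gamma| x^{n-2} + |w_{n-3}|x^{n-3} + \dots + |w_1| x + |w_0|,$$ and $$\sigma_{1}(x) = \frac{|v_{n-3}| + |v_{n-4}|}{x} + \frac{|v_{n-5}| + |v_{n-6}|}{x^{2}} + \dots + \frac{|v_1| + |v_0|}{x^{m-1}},$$ $$\sigma_{2}(x) = |\gamma| + \frac{|w_{n-3}| + |w_{n-4}|}{x} + \frac{|w_{n-5}| + |w_{n-6}|}{x^{2}} + \dots + \frac{|w_1| + |w_0|}{x^{m-1}},$$ $$\omega_{1}(x) = x^{m} - |\alpha|x^{m-1} + \bigl( |v_{n-3}| + |v_{n-4}| \bigr) x^{m-2} + \dots + \bigl( |v_{3}| + |v_{2}| \bigr) x + \bigl( |v_1| + |v_0| \bigr),$$ $$\omega_{2}(x) = x^{m} - (|\beta|-|\gamma|) x^{m-1} + \bigl( |w_{n-3}| + |w_{n-4}| \bigr) x^{m-2} + \dots + \bigl( |w_{3}| + |w_{2}| \bigr) x + \bigl( |w_1| + |w_0| \bigr).$$ Define for $x>0$ $$O_{1}(x) = \overline{O}(0;x^{2}),\quad O_{2}(x) = \overline{O}(\alpha;\rho_{1}(x)),\quad O_{3}(x)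 = \overline{O}(\beta;\rho_{2}(x)),$$ $$O'_{1}(x) = \overline{O}(0;x),\quad O'_{2}(x) = \overline{O}(\alpha;\sigma_{1}(x)),\quad O'_{3}(x) = \overline{O}(\beta;\sigma_{2}(x)).$$ If $\chi_{1}(x)=0$ has positive solutions $t_{1}\le t_{2}$, set $I_{1}=[t_{1},t_{2}]$, otherwise $I_{1}=\emptyset$. If $\chi_{2}(x)=0$ has positive solutions $u_{1}\le u_{2}$, set $I_{2}=[u_{1},u_{2}]$, otherwise $I_{2}=\emptyset$. If $\omega_{1}(x)=0$ has positive solutions $\tilde t_{1}\le\tilde t_{2}$, set $J_{1}=[\tilde t_{1},\tilde t_{2}]$, otherwise $J_{1}=\emptyset$. If $\omega_{2}(x)=0$ has positive solutions $\tilde u_{1}\le\tilde u_{2}$, set $J_{2}=[\tilde u_{1},\tilde u_{2}]$, otherwise $J_{2}=\emptyset$. Then the following holds. (a1) If $I_{1} \cap I_{2} \neq \emptyset$, set $\mu_{1} = \max\{t_{1},u_{1}\}$ and $\mu_{2} = \min\{t_{2},u_{2}\}$. Then $\ell-2$ of $p$'s zeros lie in $\overline{O}(0;\mu_{1})$, while the union $O_{2}(\mu_{2}) \cup O_{3}(\mu_{2})$ contains the squares of the two remaining zeros, i.e., $p$ has no zeros with a modulus between $\mu_{1}$ and $\left( \min \{ |\alpha| - \rho_{1}(\mu_{2}), |\beta| - \rho_{2}(\mu_{2}) \} \right)^{1/2}$. If, in addition, $|\alpha - \beta| > \rho_{1}(\mu_{2}) + \rho_{2}(\mu_{2})$, then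 $O_{2}(\mu_{2})$ and $O_{3}(\mu_{2})$ each contain one square of a zero of $p$. (a2) If $I_{1} \cap I_{2} = \emptyset$, we have the following. - If $I_{1} \neq \emptyset$ and $|\alpha-\beta| > \rho_{1}(t_{2}) + \rho_{2}(t_{2})$, then the squares of $\ell-1$ of $p$'s zeros are contained in the union $O_{1}(t_{2}) \cup O_{3}(t_{2})$, while the remaining square of a zero lies in $O_{2}(t_{2})$. - If $I_{2} \neq \emptyset$ and $|\alpha-\beta| > \rho_{1}(u_{2}) + \rho_{2}(u_{2})$, then the squares of $\ell-1$ of $p$'s zeros are contained in the union $O_{1}(u_{2}) \cup O_{2}(u_{2})$, while the remaining square of a zero lies in $O_{3}(u_{2})$. (b1) If $J_{1} \cap J_{2} \neq \emptyset$, set $\tilde\mu_{1} = \max\{\tilde t_{1},\tilde u_{1}\}$ and $\tilde\mu_{2} = \min\{\tilde t_{2},\tilde u_{2}\}$. Then $\ell-2$ of $p$'s zeros lie in $\overline{O}(0;\sqrt{\tilde\mu_{1}})$, while the union $O'_{2}(\tilde\mu_{2}) \cup O'_{3}(\tilde\mu_{2})$ contains the squares of the two remaining zeros, i.e., $p$ has no zeros with a modulus between $\sqrt{\tilde\mu_{1}}$ and $\left( \min \{ |\alpha| - \sigma_{1}(\tilde\mu_{2}), |\beta| - \sigma_{2}(\tilde\mu_{2}) \} \right)^{1/2}$. If, in addition, $|\alpha - \beta| > \sigma_{1}(\tilde\mu_{2}) + \sigma_{2}(\tilde\mu_{2})$, then $O'_{2}(\tilde\mu_{2})$ and $O'_{3}(\tilde\mu_{2})$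 each contain one square of a zero of $p$. (b2) If $J_{1} \cap J_{2} = \emptyset$, we have the following. - If $J_{1} \neq \emptyset$ and $|\alpha-\beta| > \sigma_{1}(\tilde t_{2}) + \sigma_{2}(\tilde t_{2})$, then the squares of $\ell-1$ of $p$'s zeros are contained in the union $O'_{1}(\tilde t_{2}) \cup O'_{3}(\tilde t_{2})$, while the remaining square of a zero lies in $O'_{2}(\tilde t_{2})$. - If $J_{2} \neq \emptyset$ and $|\alpha-\beta| > \sigma_{1}(\tilde u_{2}) + \sigma_{2}(\tilde u_{2})$, then the squares of $\ell-1$ of $p$'s zeros are contained in the union $O'_{1}(\tilde u_{2}) \cup O'_{2}(\tilde u_{2})$, while the remaining square of a zero lies in $O'_{3}(\tilde u_{2})$.
   Context: $\overline{O}(a;r)$ denotes the closed disc in $\mathbb{C}$ centered at $a$ with radius $r$. Zeros of $p$ (and their squares) are counted with multiplicity, so that $p$ has $\ell$ zeros. In $\chi_1,\chi_2$ the coefficient of $x^{k}$ for $0\le k\le n-3$ is $|v_k|$, respectively $|w_k|$. In $\omega_1,\omega_2$ the coefficient of $x^{k}$ for $0 \le k \le m-2$ is $|v_{2k+1}|+|v_{2k}|$, respectively $|w_{2k+1}|+|w_{2k}|$; correspondingly, $\sigma_1$ and $\sigma_2$ have the coefficient $|v_{2k+1}|+|v_{2k}|$, respectively $|w_{2k+1}|+|w_{2k}|$, at $x^{-(m-1-k)}$ for $0\le k\le m-2$. *)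

(* Defs.v *)
From mathcomp Require Import all_boot all_order all_algebra.
From mathcomp Require Import complex.
From mathcomp Require Import boolp classical_sets reals.

Set Implicit Arguments.
Unset Strict Implicit.
Unset Printing Implicit Defensive.

Import Order.TTheory GRing.Theory Num.Theory.

Local Open Scope ring_scope.
Local Open Scope complex_scope.

(* R-valued modulus on R[i]; the library's `|z| on R[i] takes values in R[i]. *)
Notation normc := ComplexField.Normc.normc.

Section Zeros.

Variable R : realType.

Definition cdisc (a : R[i]) (r : R) : {pred R[i]} :=
  [pred z | normc (z - a) <= r].

(* zs lists zeros with multiplicity: k of them satisfy P, and all the
   remaining ones satisfy Q; P and Q need not be mutually exclusive. *)
Definition zeros_split (zs : seq R[i]) (k : nat) (P Q : pred R[i]) : Prop :=
  exists zs1 zs2 : seq R[i],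
    [/\ perm_eq zs (zs1 ++ zs2), size zs1 = k, all P zs1 & all Q zs2].

(* t1 <= t2 are the positive solutions of f x = 0 (t1 = t2 if there is only
   one); in particular t1 and t2 are determined by f. *)
Definition pos_solutions (f : R -> R) (t1 t2 : R) : Prop :=
  [/\ 0 < t1, t1 <= t2 &
      forall x, 0 < x -> (f x = 0 <-> x = t1 \/ x = t2)].

Definition sol_interval (f : R -> R) : set R :=
  [set x | exists t1 t2, pos_solutions f t1 t2 /\ t1 <= x <= t2]%classic.

End Zeros.

Section Coefficients.

Variables (R : realType) (l : nat) (p : {poly R[i]}).

Definition mx22 (a b c d : R[i]) : 'M[R[i]]_2 :=
  \matrix_(i, j) if i == 0 then (if j == 0 then a else b)
                 else (if j == 0 then c else d).

(* l is the degree of p, and uphalf l is the ceiling of l / 2 *)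
Definition half_deg : nat := uphalf l.

Definition acoef (j : nat) : R[i] :=
  if odd l then (if j is j'.+1 then p`_j' else 0) else p`_j.

Definition Amx (j : nat) : 'M[R[i]]_2 :=
  let a := acoef in
  let a' := a (2 * half_deg - 1)%N in
  if j == 0%N
  then mx22 (- a 0%N) (a' * a 0%N)
            (- a 1%N) (a' * a 1%N - a 0%N)
  else mx22 (- a (2 * j)%N)   (a' * a (2 * j)%N - a (2 * j - 1)%N)
            (- a (2 * j).+1)  (a' * a (2 * j).+1 - a (2 * j)%N).

(* Entry k of the first (c = 0), resp. second (c = 1), column of the matrices
   S^-1 A_j S stacked on top of each other: entry 2j + i is entry (i, c) of
   S^-1 A_j S.  Only the indices k < n - 2 are meaningful for v and w. *)
Definition stacked_col (S : 'M[R[i]]_2) (c : 'I_2) (k : nat) : R[i] :=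
  (invmx S *m Amx k./2 *m S) (if odd k then 1 else 0) c.

Definition vvec (S : 'M[R[i]]_2) : nat -> R[i] := stacked_col S 0.
Definition wvec (S : 'M[R[i]]_2) : nat -> R[i] := stacked_col S 1.

End Coefficients.

Section RealFunctions.

Variable R : realType.
Implicit Types (m n : nat) (v w : nat -> R[i]) (alpha beta gamma : R[i]) (x : R).

Definition rho1 n v x : R :=
  \sum_(k < n - 2) normc (v k) / x ^+ (n - 2 - k).

Definition rho2 n w gamma x : R :=
  normc gamma / x + \sum_(k < n - 2) normc (w k) / x ^+ (n - 1 - k).

Definition chi1 n v alpha x : R :=
  x ^+ n - normc alpha * x ^+ (n - 2) + \sum_(k < n - 2) normc (v k) * x ^+ k.

Definition chi2 n w beta gamma x : R :=
  x ^+ n.+1 - normc beta * x ^+ (n - 1) + normc gamma * x ^+ (n - 2)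
  + \sum_(k < n - 2) normc (w k) * x ^+ k.

Definition sigma1 m v x : R :=
  \sum_(k < m - 1)
     (normc (v (2 * k).+1) + normc (v (2 * k)%N)) / x ^+ (m - 1 - k).

Definition sigma2 m w gamma x : R :=
  normc gamma +
  \sum_(k < m - 1)
     (normc (w (2 * k).+1) + normc (w (2 * k)%N)) / x ^+ (m - 1 - k).

Definition omega1 m v alpha x : R :=
  x ^+ m - normc alpha * x ^+ (m - 1) +
  \sum_(k < m - 1)
     (normc (v (2 * k).+1) + normc (v (2 * k)%N)) * x ^+ k.

Definition omega2 m w beta gamma x : R :=
  x ^+ m - (normc beta - normc gamma) * x ^+ (m - 1) +
  \sum_(k < m - 1)
     (normc (w (2 * k).+1) + normc (w (2 * k)%N)) * x ^+ k.

End RealFunctions.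

(* Main.v *)
Require Import Defs.
From mathcomp Require Import all_boot all_order all_algebra.
From mathcomp Require Import complex.
From mathcomp Require Import boolp classical_sets reals.
From mathcomp Require Import ring lra zify.

Set Implicit Arguments.
Unset Strict Implicit.
Unset Printing Implicit Defensive.

Import Order.TTheory GRing.Theory Num.Theory.

Local Open Scope ring_scope.

(* With F_j = S^-1 A_j S, the squares of the zeros of p (of z p(z) if l is odd)
   are the zeros of det (X^m - sum_j F_j X^j).  Shrinking the off-diagonal entries
   of the associated block companion matrix by a factor s in [0, 1] moves these
   zeros continuously from 0, alpha, beta; a column Gershgorin estimate for the
   2x2 matrix polynomial keeps them in the three discs shrunk by s, so that the
   number of zeros in disjoint groups of discs does not depend on s.  Discs that
   touch at s = 1 are reached as a limit from s < 1.
   When O_2 touches O_1 at the square z^2 of a zero, the limit argument does not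
   give "exactly one".  Then |z^2 - alpha| equals the radius, which forces the
   lower left entries of all F_j to vanish; this turns the left null vectors
   (1, z) S into a factorization G(z^2) e(z) = q(z) kappa(z) with linear e and
   kappa, and -z is not a zero of q when z^2 lies in O_2, so z is the only zero
   of q with z^2 in O_2 and it is simple. *)

(** * Continuity of the zeros of a polynomial *)

(** Contact of discs cannot be avoided: for x > 0, chi_1(x) = 0 says exactly x^2 + rho_1(x) =
    |alpha|, so O_1(t_2) and O_2(t_2) have radii adding up to the distance of their centres. Between
    two solutions the sum of the radii stays at most |alpha|, because it is convex in x; the same
    holds for chi_2 and both omegas. Parts (a) and (b) are one statement about a disc of radius y
    around 0. Part (b) takes y = x and the given S. Part (a) takes y = x^2 and S diag(1, 1/x), which
    gives the even and the odd entries of v and w consecutive powers of x. In (a1) and (b1) the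
    inner disc belongs to mu_1 and the outer discs to mu_2; the two localizations are glued by
    counting. For odd l the additional zero 0 lies in the inner disc and is dropped at the end. *)

Section Modulus.
Variable R : realType.
Implicit Types (x y : R[i]).

Lemma normcD x y : normc (x + y) <= normc x + normc y.
Proof. exact: le_normcD. Qed.

Lemma normc_opp x : normc (- x) = normc x.
Proof. exact: normcN. Qed.

Lemma normc_ge0 x : 0 <= normc x.
Proof. by case: x => a b; exact: sqrtr_ge0. Qed.

Lemma normcB x y : normc (x - y) = normc (y - x).
Proof. by rewrite -normc_opp opprB. Qed.

Lemma normc_triangle x y z : normc (x - z) <= normc (x - y) + normc (y - z).
Proof. by have := normcD (x - y) (y - z); rewrite addrA subrK. Qed.

Lemma normcX x n : normc (x ^+ n) = normc x ^+ n.
Proof.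
elim: n => [|n IHn]; first by rewrite !expr0 ComplexField.Normc.normc1.
by rewrite !exprS ComplexField.Normc.normcM IHn.
Qed.

Lemma normc_eq0 x : (normc x == 0) = (x == 0).
Proof.
apply/eqP/eqP => [/ComplexField.Normc.eq0_normc //|->].
exact: ComplexField.Normc.normc0.
Qed.

Lemma normc_gt0 x : (0 < normc x) = (x != 0).
Proof. by rewrite lt_def normc_eq0 normc_ge0 andbT. Qed.

Lemma normc_real (t : R) : normc t%:C%C = `|t|.
Proof. by rewrite /= expr0n addr0 sqrtr_sqr. Qed.

Lemma normc_sum (I : Type) (s : seq I) (P : pred I) (F : I -> R[i]) :
  normc (\sum_(i <- s | P i) F i) <= \sum_(i <- s | P i) normc (F i).
Proof.
elim/big_rec2: _ => [|i u v _ le_vu]; first by rewrite ComplexField.Normc.normc0.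
by apply: le_trans (normcD _ _) _; rewrite lerD2l.
Qed.

Lemma normc_prod (s : seq R[i]) (F : R[i] -> R[i]) :
  normc (\prod_(z <- s) F z) = \prod_(z <- s) normc (F z).
Proof.
elim: s => [|z s IHs]; first by rewrite !big_nil ComplexField.Normc.normc1.
by rewrite !big_cons ComplexField.Normc.normcM IHs.
Qed.

End Modulus.

Lemma ex_pos_all (R : realDomainType) (T : eqType) (s : seq T) (P : T -> R -> Prop) :
    (forall x (d d' : R), 0 < d' <= d -> P x d -> P x d') ->
    (forall x, x \in s -> exists2 d : R, 0 < d & P x d) ->
  exists2 d : R, 0 < d & forall x, x \in s -> P x d.
Proof.
move=> Pmono; elim: s => [|x s IHs] Ps; first by exists 1.
have [d1 d1_gt0 Pd1] := Ps x (mem_head _ _).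
have [|d2 d2_gt0 Pd2] := IHs; first by move=> y sy; apply: Ps; rewrite in_cons sy orbT.
exists (Num.min d1 d2); first by rewrite lt_min d1_gt0.
move=> y; rewrite in_cons => /orP[/eqP->|/Pd2 {}Pd2].
  by apply: Pmono Pd1; rewrite lt_min d1_gt0 d2_gt0 ge_min lexx.
by apply: Pmono Pd2; rewrite lt_min d1_gt0 d2_gt0 ge_min lexx orbT.
Qed.

Lemma sub_in_count (T : eqType) (s : seq T) (P Q : pred T) :
  {in s, subpred P Q} -> (count P s <= count Q s)%N.
Proof.
move=> PQ; have -> : count P s = count (predI P Q) s.
  by apply: eq_in_count => x /PQ /=; case: (P x) => //= ->.
by apply: sub_count => x /andP[].
Qed.

Section RootContinuity.
Variable R : realType.
Local Notation C := R[i].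
Implicit Types (z w : C) (zs ws : seq C) (p q r : {poly C}).

Definition coef_close p q (d : R) := forall i, normc ((p - q)`_i) <= d.

(** Synthetic division: r_i = p_(i+1) + w r_(i+1), and r_i = 0 from i = n on, so unrolling from the
    top gives a geometric sum. *)
Lemma coef_quotient_bound n p r w (B d : R) :
    p = ('X - w%:P) * r -> (size r <= n)%N -> normc w <= B ->
    (forall i, normc p`_i <= d) ->
  forall i, normc r`_i <= d * \sum_(t < n) B ^+ t.
Proof.
move=> def_p szr wB pd.
have B0 : 0 <= B := le_trans (normc_ge0 w) wB.
have d0 : 0 <= d := le_trans (normc_ge0 _) (pd 0%N).
have step i : r`_i = p`_i.+1 + w * r`_i.+1.
  by rewrite def_p mulrBl coefB coefXM coefCM subrK.
have bnd j i : (n <= i + j)%N -> normc r`_i <= d * \sum_(t < j) B ^+ t.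
  elim: j i => [|j IHj] i nij.
    rewrite nth_default ?ComplexField.Normc.normc0 ?big_ord0 ?mulr0 //.
    by move: nij; rewrite addn0; exact: leq_trans.
  rewrite step (le_trans (normcD _ _)) // ComplexField.Normc.normcM.
  rewrite big_ord_recl expr0 mulrDr mulr1 lerD //.
  under eq_bigr do rewrite lift0 exprS.
  rewrite -mulr_sumr mulrCA ler_pM ?normc_ge0 //.
  by apply: IHj; rewrite addSnnS.
by move=> i; apply: bnd; rewrite leq_addl.
Qed.

Lemma coef_bounded p : exists2 M : R, 0 < M & forall i, normc p`_i <= M.
Proof.
exists (1 + \sum_(i < size p) normc p`_i).
  by rewrite ltr_pwDl // sumr_ge0 // => i _; exact: normc_ge0.
move=> i; case: (ltnP i (size p)) => [lt_ip|le_pi].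
  rewrite (bigD1 (Ordinal lt_ip)) //= addrCA lerDl addr_ge0 // sumr_ge0 // => j _.
  exact: normc_ge0.
rewrite nth_default // ComplexField.Normc.normc0 addr_ge0 // sumr_ge0 // => j _.
exact: normc_ge0.
Qed.

Lemma horner_close_bound n p w (B d : R) :
    (size p <= n)%N -> normc w <= B -> (forall i, normc p`_i <= d) ->
  normc p.[w] <= d * \sum_(i < n) B ^+ i.
Proof.
move=> szp wB pd; rewrite (horner_coef_wide _ szp) (le_trans (normc_sum _ _ _)) //.
rewrite mulr_sumr ler_sum // => i _; rewrite ComplexField.Normc.normcM normcX.
by rewrite ler_pM ?exprn_ge0 ?normc_ge0 // lerXn2r ?nnegrE ?normc_ge0 // (le_trans _ wB) ?normc_ge0.
Qed.

Lemma prodXsubC_rem zs z : z \in zs ->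
  \prod_(x <- zs) ('X - x%:P) = ('X - z%:P) * \prod_(x <- rem z zs) ('X - x%:P).
Proof. by move=> zzs; rewrite (perm_big _ (perm_to_rem zzs)) big_cons. Qed.

(** The modulus of the value at w is the product of the distances from w to the zeros. *)
Lemma near_root zs w (e : R) : 0 <= e ->
  normc (\prod_(z <- zs) ('X - z%:P)).[w] < e ^+ size zs ->
  exists2 z, z \in zs & normc (z - w) < e.
Proof.
move=> e0; rewrite horner_prod normc_prod => small.
case: (boolP (has (fun z => normc (z - w) < e) zs)) => [/hasP[z]|]; first by exists z.
rewrite -all_predC => /allP far; suff: false by [].
apply: contraTT small => _; rewrite -leNgt.
elim: zs far => [|z zs IHzs] far; first by rewrite big_nil expr0.
rewrite big_cons exprS ler_pM ?exprn_ge0 //.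
  by rewrite !hornerE normcB leNgt; apply: far; exact: mem_head.
by apply: IHzs => x xzs; apply: far; rewrite in_cons xzs orbT.
Qed.

(** Induction on the number of zeros: the first polynomial is small at w, so some z is near w, and
    the quotients by X - z and X - w are close again. The bound [B] makes [d] independent of
    [ws]. *)
Lemma roots_continuous zs (B e : R) : 0 < e -> exists2 d : R, 0 < d &
  forall ws, size ws = size zs -> all (fun w => normc w <= B) ws ->
    coef_close (\prod_(z <- zs) ('X - z%:P)) (\prod_(w <- ws) ('X - w%:P)) d ->
  exists2 zs', perm_eq zs zs' & all2 (fun z w => normc (z - w) <= e) zs' ws.
Proof.
move=> e0; have [n] := ubnP (size zs); elim: n zs => // n IHn zs szn.
case: (ltP B 0) => [B0|B0].
  exists 1 => // -[|w ws] szw /=; first by exists zs; rewrite ?(size0nil (esym szw)).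
  by move=> /andP[wB]; have := le_lt_trans wB B0; rewrite ltNge normc_ge0.
(* A single [d] for all z serves as tolerance for the remaining zeros and as inverse bound on the
   coefficients of their product. *)
have [||d d0 Pd] := @ex_pos_all R _ zs (fun z d =>
   [/\ forall i, d * normc (\prod_(x <- rem z zs) ('X - x%:P))`_i <= 1 &
       forall ws, size ws = size (rem z zs) -> all (fun w => normc w <= B) ws ->
    coef_close (\prod_(z <- rem z zs) ('X - z%:P)) (\prod_(w <- ws) ('X - w%:P)) d ->
    exists2 zs', perm_eq (rem z zs) zs' & all2 (fun z w => normc (z - w) <= e) zs' ws]).
- move=> z d d' /andP[d'0 d'd] [Pd1 Pd2]; split=> [i|ws szw wsB clo].
    by apply: le_trans (Pd1 i); rewrite ler_wpM2r ?normc_ge0.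
  by apply: Pd2 => // i; exact: le_trans (clo i) d'd.
- move=> z zzs; have [|d1 d10 Pd1] := IHn (rem z zs).
    by rewrite size_rem // -ltnS (leq_trans _ szn) //; case: (zs) zzs.
  have [M M0 PM] := coef_bounded (\prod_(x <- rem z zs) ('X - x%:P)).
  exists (Num.min d1 M^-1); first by rewrite lt_min d10 invr_gt0.
  split=> [i|ws szw wsB clo].
    apply: (@le_trans _ _ (M^-1 * M)); last by rewrite mulVf ?gt_eqF.
    by rewrite ler_pM ?normc_ge0 ?ge_min ?lexx ?orbT // le_min !ltW ?invr_gt0.
  by apply: Pd1 => // i; apply: le_trans (clo i) _; rewrite ge_min lexx.
pose c : R := \sum_(i < (size zs).+1) B ^+ i.
have c0 : 0 < c.
  by rewrite /c big_ord_recl expr0 ltr_pwDl // sumr_ge0 // => i _; exact: exprn_ge0.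
(* The errors d' and e'/d are each at most d/(2c), and division by X - w costs the factor c, so the
   quotients differ by at most d. The power of [e'] inside [d'] is what [near_root] asks for. *)
pose e' := Num.min e (d * d / (2 * c)).
have e'0 : 0 < e' by rewrite lt_min e0 !(divr_gt0, mulr_gt0).
pose d' := Num.min (d / (2 * c)) (e' ^+ size zs / (2 * c)).
have d'0 : 0 < d' by rewrite lt_min !(divr_gt0, mulr_gt0, exprn_gt0).
exists d' => // -[|w ws] /=.
  by move=> sz0 _ _; exists zs; rewrite // (size0nil (esym sz0)).
move=> szw /andP[wB wsB] clo.
set P := \prod_(z <- zs) _ in clo; set Q := \prod_(w <- _) _ in clo.
have szPQ : (size (P - Q)%R <= (size zs).+1)%N.
  by rewrite (leq_trans (size_polyD _ _)) // size_polyN !size_prod_XsubC /= szw maxnn.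
have [|z zzs zw] := @near_root zs w e' (ltW e'0).
  have -> : P.[w] = (P - Q).[w].
    by rewrite [RHS]hornerE hornerN /Q big_cons hornerM hornerXsubC subrr mul0r subr0.
  apply: le_lt_trans (horner_close_bound szPQ wB clo) _; rewrite -/c.
  apply: (@le_lt_trans _ _ (e' ^+ size zs / (2 * c) * c)).
    by rewrite ler_wpM2r ?(ltW c0) // ge_min lexx orbT.
  have := exprn_gt0 (size zs) e'0; move: (e' ^+ size zs) => E E0.
  by rewrite (_ : E / (2 * c) * c = E / 2); [lra | field; rewrite gt_eqF].
have [Pd1 Pd2] := Pd z zzs.
have [|||zs' zs'P zs'ws] := Pd2 ws => //; first by rewrite size_rem // -szw.
  pose r := \prod_(x <- rem z zs) ('X - x%:P) - \prod_(x <- ws) ('X - x%:P).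
  have szr : (size r <= (size zs).+1)%N.
    rewrite (leq_trans (size_polyD _ _)) // size_polyN !size_prod_XsubC size_rem //.
    by rewrite -szw /= maxnn ltnS.
  (* With P = (X - z) P1 and Q = (X - w) Q1 one has P - Q - (w - z) P1 = (X - w) (P1 - Q1). *)
  move=> i; apply: le_trans (coef_quotient_bound (n := (size zs).+1)
    (p := P - Q - (w - z)%:P * \prod_(x <- rem z zs) ('X - x%:P)) (d := d' + e' / d)
     _ szr wB _ i) _.
  - by rewrite /P (prodXsubC_rem zzs) /Q big_cons /r polyCB; ring.
  - move=> {}i; rewrite coefB coefCM (le_trans (normcD _ _)) // lerD //.
    rewrite normc_opp ComplexField.Normc.normcM ler_pM ?normc_ge0 //.
      by rewrite normcB ltW.
    by rewrite -[d^-1]mul1r ler_pdivlMr // mulrC.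
  rewrite -/c; have d'l : d' <= d / (2 * c) by rewrite ge_min lexx.
  have e'l : e' / d <= d / (2 * c).
    rewrite ler_pdivrMr // (@le_trans _ _ (d * d / (2 * c))) ?ge_min ?lexx ?orbT //.
    by rewrite mulrAC.
  apply: (@le_trans _ _ ((d / (2 * c) + d / (2 * c)) * c)).
    by rewrite ler_wpM2r ?(ltW c0) // lerD.
  by rewrite le_eqVlt; apply/orP; left; apply/eqP; field; rewrite gt_eqF.
exists (z :: zs'); first by rewrite (permPl (perm_to_rem zzs)) perm_cons.
by rewrite /= zs'ws andbT (le_trans (ltW zw)) // ge_min lexx.
Qed.

End RootContinuity.

(** * Counting zeros along a path of polynomials *)

(** Zeros failing Q are forced into the first group, zeros failing P into the second, and those
    satisfying both fill up the first group to size k. *)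
Lemma zeros_split_countP (R : realType) (zs : seq R[i]) k (P Q : pred R[i]) :
  zeros_split zs k P Q <->
  [/\ all (predU P Q) zs, (count (predC Q) zs <= k)%N &
      (count (predC P) zs + k <= size zs)%N].
Proof.
split=> [[zs1 [zs2 [zsE <- P1 Q2]]]|[PQ cQ cP]].
  have cPQ : count (predC P) zs1 = 0%N /\ count (predC Q) zs2 = 0%N.
    by split; apply/eqP; rewrite -leqn0 leqNgt -has_count has_predC negbK.
  have szE := perm_size zsE; rewrite size_cat in szE.
  rewrite (perm_all _ zsE) !(permP zsE) !count_cat all_cat szE; case: cPQ => -> ->.
  split; last by rewrite addnC leq_add2l count_size.
    by apply/andP; split; [apply: sub_all P1|apply: sub_all Q2] => z /= ->; rewrite ?orbT.
  by rewrite addn0 count_size.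
pose A := filter (predC Q) zs; pose B := filter P (filter Q zs).
pose D := filter (predC P) (filter Q zs).
have zsE : perm_eq zs (A ++ B ++ D).
  rewrite perm_sym /A /B /D perm_catC.
  apply: perm_trans (permEl (perm_filterC Q zs)); rewrite perm_cat2r.
  exact: permEl (perm_filterC P _).
have szA : size A = count (predC Q) zs by rewrite size_filter.
have szD : size D = count (predC P) zs.
  rewrite !size_filter count_filter; apply: eq_in_count => z /(allP PQ) /=.
  by case: (P z).
have szE := perm_size zsE; rewrite !size_cat in szE.
exists (A ++ take (k - size A) B), (drop (k - size A) B ++ D); split.
- by rewrite -catA; rewrite (catA (take _ _)) cat_take_drop.
- rewrite size_cat size_takel ?szA ?subnKC //.
  by rewrite leq_subLR; move: cP; rewrite szE szA szD addnA addnC leq_add2r.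
- rewrite all_cat; apply/andP; split.
    apply/allP=> z; rewrite mem_filter => /andP[/= nQz /(allP PQ) /=].
    by rewrite (negPf nQz) orbF.
  by apply/allP=> z /mem_take; rewrite mem_filter => /andP[].
- rewrite all_cat; apply/andP; split.
    by apply/allP=> z /mem_drop; rewrite !mem_filter => /and3P[].
  by apply/allP=> z; rewrite !mem_filter => /and3P[].
Qed.

(** Connectedness of [0, 1]: the supremum of the s with Q on [0, s] is attained and cannot be below
    1. *)
Lemma unit_interval_induction (R : realType) (Q : R -> Prop) :
    Q 0 ->
    (forall s, 0 <= s <= 1 -> exists2 d : R, 0 < d &
       forall s', 0 <= s' <= 1 -> `|s - s'| < d -> (Q s <-> Q s')) ->
  Q 1.
Proof.
move=> Q0 Qloc.
pose E := [set s : R | 0 <= s <= 1 /\ forall s', 0 <= s' <= s -> Q s']%classic.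
have E0 : E 0.
  split=> [|s' s'0]; first by rewrite lexx ler01.
  by have <- : 0 = s' by apply/eqP; rewrite eq_le.
have supE : has_sup E.
  by split; [exists 0 | exists 1 => s [/andP[]]].
pose c := sup E.
have c01 : 0 <= c <= 1.
  by rewrite sup_upper_bound //= ge_sup //; [exists 0 | move=> s [/andP[]]].
have [d d0 Qd] := Qloc c c01.
have [e [e01 Qe] ce] := sup_adherent d0 supE; rewrite -/c in ce.
have ec : e <= c by apply: sup_upper_bound.
have Qc : Q c.
  apply/(Qd e e01); first by rewrite ger0_norm ?subr_ge0 //; lra.
  by apply: Qe; case/andP: e01 => ->; rewrite lexx.
pose s1 := Num.min 1 (c + d / 2).
have Es1 : E s1.
  split=> [|s' /andP[s'0 s's1]].
    by rewrite le_min ler01 ge_min lexx; case/andP: c01 => c0 _; lra.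
  have [s'1 s'c] : s' <= 1 /\ s' <= c + d / 2.
    by move: s's1; rewrite le_min => /andP[].
  case: (leP s' e) => [s'e|es']; first by apply: Qe; rewrite s'0.
  apply/(Qd s') => //; first by rewrite s'0.
  by rewrite ltr_norml; apply/andP; split; lra.
have s1c : s1 <= c by apply: sup_upper_bound.
have s11 : s1 = 1.
  by move: s1c; rewrite /s1; case: (leP 1 (c + d / 2)) => // _; lra.
by case: Es1 => _; apply; rewrite s11 lexx ler01.
Qed.

Section Homotopy.
Variable R : realType.
Local Notation C := R[i].
Implicit Types (z w : C) (zs ws : seq C) (U V : pred C).

Definition closed_pred U :=
  forall z, ~~ U z -> exists2 e : R, 0 < e & forall w, normc (z - w) <= e -> ~~ U w.

(** A zero outside U or V keeps a positive distance from it, so matching each zero with a close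
    perturbed one, position by position, carries the groups back to [zs]. *)
Lemma zeros_split_limit zs U V (B : R) : closed_pred U -> closed_pred V ->
  exists2 d : R, 0 < d &
    forall ws k, size ws = size zs -> all (fun w => normc w <= B) ws ->
      coef_close (\prod_(z <- zs) ('X - z%:P)) (\prod_(w <- ws) ('X - w%:P)) d ->
    zeros_split ws k U V -> zeros_split zs k U V.
Proof.
move=> clU clV.
have [||e e0 UVe] := @ex_pos_all R _ zs (fun z e =>
  forall w, normc (z - w) <= e -> (U w -> U z) /\ (V w -> V z)).
- by move=> z e e' /andP[_ e'e] Pe w zw; apply: Pe; exact: le_trans e'e.
- have aux W z : closed_pred W ->
      exists2 e : R, 0 < e & forall w, normc (z - w) <= e -> W w -> W z.
    move=> clW; case: (boolP (W z)) => [Wz|/clW[e e0 We]]; first by exists 1.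
    by exists e => // w /We/negPf->.
  move=> z _; have [e1 e10 Ue] := aux U z clU; have [e2 e20 Ve] := aux V z clV.
  exists (Num.min e1 e2); first by rewrite lt_min e10.
  by move=> w; rewrite le_min => /andP[zw1 zw2]; split; [exact: Ue | exact: Ve].
have [d d0 Pd] := @roots_continuous R zs B e e0.
exists d => // ws k szw wsB clo [ws1 [ws2 [wsE szk U1 V2]]].
have [|||zs' zsE] := Pd (ws1 ++ ws2).
- by rewrite -(perm_size wsE).
- by rewrite -(perm_all _ wsE).
- by rewrite -(perm_big _ wsE).
rewrite all2E => /andP[/eqP szE close].
have szk' : (k <= size zs')%N by rewrite szE size_cat szk leq_addr.
have szt : size (take k zs') = size ws1 by rewrite size_takel ?szk.
exists (take k zs'), (drop k zs'); rewrite cat_take_drop size_takel //.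
have szd : size (drop k zs') = size ws2 by rewrite size_drop szE size_cat szk addKn.
have sub : {subset zs' <= zs} by move=> z; rewrite (perm_mem zsE).
move: close sub; rewrite -{1 2}[zs'](cat_take_drop k) zip_cat // all_cat.
move=> /andP[close1 close2] sub; split=> //.
  apply/(all_nthP 0) => j ltj; have [] := UVe (take k zs')`_j _ ws1`_j.
  - by apply: sub; rewrite mem_cat mem_nth.
  - have := all_nthP (0, 0) close1 j; rewrite size_zip -szt minnn => /(_ ltj).
    by rewrite nth_zip.
  - by move=> + _; apply; apply: (all_nthP 0 U1); rewrite -szt.
apply/(all_nthP 0) => j ltj; have [] := UVe (drop k zs')`_j _ ws2`_j.
- by apply: sub; rewrite mem_cat (mem_nth 0 ltj) orbT.
- have := all_nthP (0, 0) close2 j; rewrite size_zip -szd minnn => /(_ ltj).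
  by rewrite nth_zip.
- by move=> _; apply; apply: (all_nthP 0 V2); rewrite -szd.
Qed.

Variables (n : nat) (F : R -> {poly C}) (L : R).
Hypothesis F_monic : forall s, 0 <= s <= 1 -> F s \is monic /\ size (F s) = n.+1.
Hypothesis F_lip : forall s s', 0 <= s <= 1 -> 0 <= s' <= 1 ->
  coef_close (F s) (F s') (L * `|s - s'|).

Lemma family_roots s : 0 <= s <= 1 ->
  exists2 ws, F s = \prod_(w <- ws) ('X - w%:P) & size ws = n.
Proof.
move=> /F_monic[Fm szF]; have [ws defF] := closed_field_poly_normal (F s).
exists ws; first by rewrite {1}defF (monicP Fm) scale1r.
by apply: succn_inj; rewrite -szF defF (monicP Fm) scale1r size_prod_XsubC.
Qed.

Lemma family_limit s U V (B : R) zs :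
    0 <= s <= 1 -> closed_pred U -> closed_pred V ->
    F s = \prod_(z <- zs) ('X - z%:P) ->
  exists2 d : R, 0 < d & forall s' ws k, 0 <= s' <= 1 -> `|s - s'| < d ->
    F s' = \prod_(w <- ws) ('X - w%:P) -> all (fun w => normc w <= B) ws ->
    zeros_split ws k U V -> zeros_split zs k U V.
Proof.
move=> s01 clU clV Fs; have [d d0 Pd] := @zeros_split_limit zs U V B clU clV.
have L0 : 0 < `|L| + 1 by rewrite ltr_pwDr.
exists (d / (`|L| + 1)); first by rewrite divr_gt0.
move=> s' ws k s'01 ss' Fs' wsB; apply: Pd => //.
  apply: succn_inj; rewrite -!(size_prod_XsubC _ id) -Fs -Fs'.
  by rewrite (F_monic s01).2 (F_monic s'01).2.
rewrite -Fs -Fs' => i; apply: le_trans (F_lip s01 s'01 i) _.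
move: ss'; rewrite ltr_pdivlMr // => /ltW; apply: le_trans.
rewrite mulrC ler_wpM2l //; have := ler_norm L; lra.
Qed.

Lemma homotopy_count U V (B : R) ws0 ws1 :
    closed_pred U -> closed_pred V ->
    (forall z, U z -> ~~ V z) -> (forall z, U z || V z -> normc z <= B) ->
    (forall s z, 0 <= s <= 1 -> root (F s) z -> U z || V z) ->
    F 0 = \prod_(w <- ws0) ('X - w%:P) -> F 1 = \prod_(w <- ws1) ('X - w%:P) ->
  count U ws0 = count U ws1.
Proof.
move=> clU clV UV UVB rootF F0 F1.
pose Q s := forall ws, F s = \prod_(w <- ws) ('X - w%:P) -> count U ws = count U ws0.
have uniqF ws ws' s : F s = \prod_(w <- ws) ('X - w%:P) ->
    F s = \prod_(w <- ws') ('X - w%:P) -> count U ws = count U ws'.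
  by move=> -> /prod_XsubC_eq/permP.
suff /(_ ws1 F1) -> : Q 1 by [].
have F_all ws s : 0 <= s <= 1 -> F s = \prod_(w <- ws) ('X - w%:P) ->
    all (predU U V) ws.
  move=> s01 Fs; apply/allP => z wsz /=; apply: (rootF s) => //.
  by rewrite Fs root_prod_XsubC.
(* U and V are disjoint, so splits record exact counts and [family_limit] compares the counts at s
   and at nearby s'. *)
have splitE ws k : all (predU U V) ws -> zeros_split ws k U V <-> count U ws = k.
  move=> UVws; have CE : count (predC V) ws = count U ws.
    apply: eq_in_count => z /(allP UVws) /=.
    by case: (boolP (U z)) => [/UV->|_ /= ->].
  rewrite zeros_split_countP UVws CE -(count_predC U ws) addnC leq_add2r.
  by split=> [[_ c1 c2]|<-]; [apply/eqP; rewrite eqn_leq c1 | ].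
apply: unit_interval_induction => [ws Fws|s s01]; first exact: uniqF Fws F0.
have [zs Fs szs] := family_roots s01.
have [d d0 Pd] := family_limit B s01 clU clV Fs.
exists d => // s' s'01 ss'; have [ws Fs' szw] := family_roots s'01.
have allw := F_all _ _ s'01 Fs'; have allz := F_all _ _ s01 Fs.
have : count U zs = count U ws.
  apply/(splitE _ _ allz); apply: (Pd s' ws) => //; last exact/splitE.
  by apply: sub_all allw => z; exact: UVB.
move=> cE; split=> Qs ws' Fws'.
  by rewrite (uniqF ws' ws s') // -cE; apply: Qs.
by rewrite (uniqF ws' zs s) // cE; apply: Qs.
Qed.

End Homotopy.

(** * Groups of discs with a common shrinking factor *)

Section Discs.
Variable R : realType.
Local Notation C := R[i].
Implicit Types (z w : C) (zs ws : seq C) (ds : seq (C * R)).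

Definition in_discs ds (t : R) : pred C :=
  fun z => has (fun d => normc (z - d.1) <= t * d.2) ds.

Lemma in_discs_cat ds1 ds2 t z :
  in_discs (ds1 ++ ds2) t z = in_discs ds1 t z || in_discs ds2 t z.
Proof. exact: has_cat. Qed.

Lemma in_discs_closed ds t : closed_pred (in_discs ds t).
Proof.
move=> z; rewrite /in_discs -all_predC => /allP zds.
have [||e e0 Pe] := @ex_pos_all R _ ds (fun d e =>
  forall w, normc (z - w) <= e -> t * d.2 < normc (w - d.1)).
- by move=> d e e' /andP[_ e'e] Pe w zw; apply: Pe; exact: le_trans e'e.
- move=> d /zds /=; rewrite -ltNge => zd.
  exists ((normc (z - d.1) - t * d.2) / 2); first by rewrite divr_gt0 // subr_gt0.
  by move=> w zw; have := normc_triangle z w d.1; lra.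
exists e => // w zw; rewrite -all_predC; apply/allP => d dds /=.
by rewrite -ltNge; apply: Pe.
Qed.

Lemma in_discs_bounded ds t : exists B : R, forall z, in_discs ds t z -> normc z <= B.
Proof.
elim: ds => [|d ds [B PB]]; first by exists 0.
exists (Num.max B (t * d.2 + normc d.1)) => z /= /orP[zd|/PB zB].
  rewrite le_max; apply/orP; right; have := normcD (z - d.1) d.1; rewrite subrK.
  by move/le_trans; apply; rewrite lerD2r.
by rewrite le_max zB.
Qed.

Variables (n : nat) (F : R -> {poly C}) (L : R).
Hypothesis F_monic : forall s, 0 <= s <= 1 -> F s \is monic /\ size (F s) = n.+1.
Hypothesis F_lip : forall s s', 0 <= s <= 1 -> 0 <= s' <= 1 ->
  coef_close (F s) (F s') (L * `|s - s'|).

(* For t < 1 the two families of discs of radii t * r are disjoint, so the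
   homotopy argument applies to F on [0, t]; discs that touch only at t = 1 are
   reached by continuity of the zeros. *)
Lemma discs_homotopy ds1 ds2 ws0 ws1 :
    (forall d, d \in ds1 ++ ds2 -> 0 <= d.2) ->
    (forall d1 d2, d1 \in ds1 -> d2 \in ds2 ->
       d1.1 != d2.1 /\ d1.2 + d2.2 <= normc (d1.1 - d2.1)) ->
    (forall s z, 0 <= s <= 1 -> root (F s) z -> in_discs (ds1 ++ ds2) s z) ->
    F 0 = \prod_(w <- ws0) ('X - w%:P) -> F 1 = \prod_(w <- ws1) ('X - w%:P) ->
    all (fun w => w \in map fst ds1 ++ map fst ds2) ws0 ->
  zeros_split ws1 (count (fun w => w \in map fst ds1) ws0)
    (in_discs ds1 1) (in_discs ds2 1).
Proof.
move=> ds0 sep rootF F0 F1 ws0in; set k := count _ _.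
have mono ds (s t : R) z : (forall d, d \in ds -> 0 <= d.2) -> 0 <= s <= t ->
    in_discs ds s z -> in_discs ds t z.
  move=> dsp /andP[s0 st] /hasP[d dds zd]; apply/hasP; exists d => //.
  by apply: le_trans zd _; rewrite ler_wpM2r ?dsp.
have ds10 d : d \in ds1 -> 0 <= d.2 by move=> dds; apply: ds0; rewrite mem_cat dds.
have ds20 d : d \in ds2 -> 0 <= d.2 by move=> dds; apply: ds0; rewrite mem_cat dds orbT.
have i1 : 0 <= (1 : R) <= 1 by rewrite ler01 lexx.
have [B PB] := in_discs_bounded (ds1 ++ ds2) 1.
have [d d0 Pd] := family_limit F_monic F_lip B i1
  (@in_discs_closed ds1 1) (@in_discs_closed ds2 1) F1.
pose t := 1 - Num.min d 1 / 2.
have [t0 t1 td] : [/\ 0 <= t, t < 1 & `|1 - t| < d].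
  have m0 : 0 < Num.min d 1 by rewrite lt_min d0 ltr01.
  have m1 : Num.min d 1 <= 1 by rewrite ge_min lexx orbT.
  have md : Num.min d 1 <= d by rewrite ge_min lexx.
  by rewrite /t; split; [lra|lra|rewrite ltr_norml; apply/andP; split; lra].
have t01 : 0 <= t <= 1 by rewrite t0 ltW.
have [ws Ft szw] := family_roots F_monic t01.
have allw : all (in_discs (ds1 ++ ds2) t) ws.
  by apply/allP => z zws; apply: rootF => //; rewrite Ft root_prod_XsubC.
have disj z : in_discs ds1 t z -> ~~ in_discs ds2 t z.
  move=> /hasP[d1 d1s zd1]; apply/hasPn => d2 d2s; rewrite -ltNge.
  have [ne le12] := sep _ _ d1s d2s.
  rewrite -subr_eq0 -normc_gt0 in ne.
  have := normc_triangle d1.1 z d2.1; rewrite (normcB d1.1 z) => tri.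
  have := ds10 _ d1s; have := ds20 _ d2s => p2 p1.
  suff : t * d1.2 + t * d2.2 < normc (d1.1 - d2.1) by lra.
  (* A positive sum of radii shrinks strictly because t < 1; if both radii vanish, strictness comes
     from the distinct centres. *)
  rewrite -mulrDr; case: (ltP 0 (d1.2 + d2.2)) => [p|p].
    by apply: lt_le_trans le12; rewrite gtr_pMl.
  have -> : d1.2 + d2.2 = 0 by lra.
  by rewrite mulr0.
have cnt : count (in_discs ds1 t) ws = k.
  have [Bt PBt] := in_discs_bounded (ds1 ++ ds2) t.
  have itv s : 0 <= s <= 1 -> 0 <= s * t <= 1.
    move=> /andP[s0 s1]; rewrite mulr_ge0 //= (le_trans (ler_pM s0 t0 s1 (ltW t1))) //.
    by rewrite mulr1.
  have itv' s : 0 <= s <= 1 -> 0 <= s * t <= t.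
    by move=> /andP[s0 s1]; rewrite mulr_ge0 //= ler_piMl.
  rewrite -(@homotopy_count R n (fun s => F (s * t)) (L * t) _ _
    (in_discs ds1 t) (in_discs ds2 t) Bt ws0 ws) ?mul0r ?mul1r //.
  - apply: eq_in_count => z z0; apply/hasP/mapP => [[d1 d1s zd1]|[d1 d1s ->]].
      have := allP ws0in _ z0; rewrite mem_cat => /orP[/mapP//|/mapP[d2 d2s zE]].
      have : in_discs ds2 t z.
        apply/hasP; exists d2 => //; rewrite zE subrr ComplexField.Normc.normc0.
        by rewrite mulr_ge0 // ds20.
      by rewrite (negPf (disj z _)) //; apply/hasP; exists d1.
    by exists d1 => //; rewrite subrr ComplexField.Normc.normc0 mulr_ge0 // ds10.
  - by move=> s /itv; exact: F_monic.
  - move=> s s' s01 s'01 i; apply: le_trans (F_lip (itv _ s01) (itv _ s'01) i) _.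
    by rewrite -mulrBl normrM (ger0_norm t0) mulrA mulrAC.
  - exact: in_discs_closed.
  - exact: in_discs_closed.
  - by move=> z; rewrite -has_cat; exact: PBt.
  - move=> s z s01 /(rootF _ _ (itv _ s01)) /(mono _ _ _ _ ds0 (itv' _ s01)).
    by rewrite /in_discs has_cat.
apply: (Pd t ws) => //.
  by apply: sub_all allw => z /(mono _ _ _ _ ds0 t01); exact: PB.
(* Growing the discs from t to 1 may make them touch, so the exact count weakens to a split, which
   tolerates zeros in both groups. *)
apply/zeros_split_countP; split.
- apply: sub_all allw => z; rewrite in_discs_cat /= => /orP[] zd.
    by rewrite (mono ds1 t 1).
  by rewrite (mono ds2 t 1) ?orbT.
- rewrite -cnt; apply: sub_in_count => z /(allP allw).
  by rewrite in_discs_cat /= => /orP[-> //|/(mono _ _ _ _ ds20 t01) ->].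
- rewrite -cnt -(count_predC (in_discs ds1 t) ws) addnC leq_add2l.
  by apply: sub_count => z /=; apply: contra; exact: mono.
Qed.

End Discs.

(** * Determinants of 2x2 matrix polynomials *)

(* The pencil stands for the block companion matrix of the matrix polynomial
   X^(k+1) - sum_j F_j X^j with 2x2 coefficients F_j = [[a j, b j], [c j, d j]]:
   scaling every off-diagonal entry of that n x n matrix by s turns its
   characteristic polynomial into [pencil a b c d s]. *)
Section Pencil.
Variable k : nat.

(** The block F_j is linked to the diagonal through k - j identity blocks off the diagonal; with the
    entry itself this makes k + 1 - j factors s. Only [a k] sits on the diagonal and carries
    none. *)
Definition pdiag (A : comNzRingType) (a : nat -> A) (s : A) : {poly A} :=
  'X^(k.+1) - (a k)%:P * 'X^k - \sum_(j < k) (s ^+ (k.+1 - j) * a j)%:P * 'X^j.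

Definition poff (A : comNzRingType) (c : nat -> A) (s : A) : {poly A} :=
  \sum_(j < k.+1) (s ^+ (k.+1 - j) * c j)%:P * 'X^j.

Definition pencil (A : comNzRingType) (a b c d : nat -> A) (s : A) : {poly A} :=
  pdiag a s * pdiag d s - poff b s * poff c s.

Lemma map_pencil (A B : comNzRingType) (f : {rmorphism A -> B}) a b c d s :
  map_poly f (pencil a b c d s) = pencil (f \o a) (f \o b) (f \o c) (f \o d) (f s).
Proof.
have fdiag e : map_poly f (pdiag e s) = pdiag (f \o e) (f s).
  rewrite /pdiag !rmorphB rmorphM /= !map_polyXn map_polyC rmorph_sum /=.
  congr (_ - _); apply: eq_bigr => j _.
  by rewrite rmorphM /= map_polyXn map_polyC /= rmorphM rmorphXn.
have foff e : map_poly f (poff e s) = poff (f \o e) (f s).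
  rewrite /poff rmorph_sum; apply: eq_bigr => j _.
  by rewrite rmorphM /= map_polyXn map_polyC /= rmorphM rmorphXn.
by rewrite /pencil rmorphB !rmorphM /= !fdiag !foff.
Qed.

Lemma horner_pdiag (A : comNzRingType) (a : nat -> A) s x :
  (pdiag a s).[x] =
  x ^+ k.+1 - a k * x ^+ k - \sum_(j < k) s ^+ (k.+1 - j) * a j * x ^+ j.
Proof.
rewrite /pdiag !hornerE horner_sum; congr (_ - _).
by apply: eq_bigr => j _; rewrite !hornerE.
Qed.

Lemma horner_poff (A : comNzRingType) (c : nat -> A) s x :
  (poff c s).[x] = \sum_(j < k.+1) s ^+ (k.+1 - j) * c j * x ^+ j.
Proof. by rewrite horner_sum; apply: eq_bigr => j _; rewrite !hornerE. Qed.

(** Start of the homotopy: all exponents of s are positive, so only the diagonal survives, and the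
    zeros are the centres of the discs. *)
Lemma pencil0 (A : comNzRingType) (a b c d : nat -> A) :
  pencil a b c d 0 = \prod_(w <- nseq (2 * k) 0 ++ [:: a k; d k]) ('X - w%:P).
Proof.
have d0 e : pdiag e 0 = 'X^k * ('X - (e k)%:P) :> {poly A}.
  rewrite /pdiag big1 ?subr0; first by rewrite exprSr mulrBr [_%:P * _]mulrC.
  by move=> j _; rewrite expr0n subn_eq0 leqNgt ltnS ltnW //= mul0r mul0r.
have o0 e : poff e 0 = 0 :> {poly A}.
  rewrite /poff big1 // => j _.
  by rewrite expr0n subn_eq0 leqNgt ltn_ord /= mul0r mul0r.
rewrite /pencil !d0 !o0 mul0r subr0 big_cat big_nseq /= !big_cons big_nil subr0 mulr1.
by rewrite iter_mulr_1 mulrACA -exprD addnn -mul2n.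
Qed.

Lemma size_sum_lt (A : comNzRingType) m n (f : nat -> A) : (n <= m)%N ->
  (size (\sum_(j < n) (f j)%:P * 'X^j)%R <= m)%N.
Proof.
move=> nm; apply: (leq_trans (size_sum _ _ _)); apply/bigmax_leqP => j _.
rewrite mul_polyC (leq_trans (size_scale_leq _ _)) // size_polyXn.
exact: leq_trans (ltn_ord j) nm.
Qed.

Lemma pencil_monic (A : idomainType) (a b c d : nat -> A) s :
  pencil a b c d s \is monic /\ size (pencil a b c d s) = (2 * k.+1).+1.
Proof.
have diagE e : exists2 r : {poly A}, pdiag e s = 'X^(k.+1) + r & (size r <= k.+1)%N.
  exists (- ((e k)%:P * 'X^k + \sum_(j < k) (s ^+ (k.+1 - j) * e j)%:P * 'X^j)).
    by rewrite /pdiag opprD addrA.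
  rewrite size_polyN (leq_trans (size_polyD _ _)) // geq_max.
  apply/andP; split; last exact: (size_sum_lt (fun j => s ^+ (k.+1 - j) * e j)).
  by rewrite mul_polyC (leq_trans (size_scale_leq _ _)) ?size_polyXn.
have diagP e : pdiag e s \is monic /\ size (pdiag e s) = k.+2.
  have [r -> szr] := diagE e; have szX : (size r < size ('X^(k.+1) : {poly A}))%N.
    by rewrite size_polyXn.
  by rewrite monicE lead_coefDl // lead_coefXn eqxx size_polyDl // size_polyXn.
have [[ma sa] [md sd]] := (diagP a, diagP d).
have szM : size (pdiag a s * pdiag d s) = (2 * k.+1).+1.
  by rewrite size_monicM ?monic_neq0 // sa sd mul2n -addnn addnS.
have szo : (size (- (poff b s * poff c s))%R < size (pdiag a s * pdiag d s)%R)%N.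
  have szp e : (size (poff e s) <= k.+1)%N.
    exact: (size_sum_lt (fun j => s ^+ (k.+1 - j) * e j)).
  rewrite szM size_polyN ltnS (leq_trans (size_polyMleq _ _)) //.
  by rewrite mul2n -addnn (leq_trans (leq_pred _)) // leq_add.
by rewrite /pencil monicE lead_coefDl // -monicE size_polyDl // szM monicMr.
Qed.

End Pencil.

(** The columns (E, A) and (D, B) of the adjugate are null vectors of a singular matrix; if both
    vanish, so does the matrix. *)
Lemma null_vector2 (F : fieldType) (A B D E : F) : A * D = B * E ->
  exists e o : F, [/\ (e != 0) || (o != 0), A * e = E * o & D * o = B * e].
Proof.
move=> ADBE; case: (boolP ((E != 0) || (A != 0))) => [EA|].
  by exists E, A; split; rewrite // mulrC // ADBE.
rewrite negb_or !negbK => /andP[/eqP-> /eqP->].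
case: (boolP ((D != 0) || (B != 0))) => [DB|].
  by exists D, B; rewrite DB !mul0r mulrC.
rewrite negb_or !negbK => /andP[/eqP-> /eqP->].
by exists 1, 0; rewrite oner_eq0 !mul0r.
Qed.

(** * Column Gershgorin estimate for the pencil *)

Section PencilDiscs.
Variables (R : realType) (k : nat) (y : R).
Hypothesis y0 : 0 < y.
Local Notation C := R[i].
Implicit Types (a b c d : nat -> C) (z w e o : C) (s : R).

Lemma lipschitz_horner (p : {poly C}) : exists2 L : R, 0 <= L &
  forall x x' : C, normc x <= 1 -> normc x' <= 1 ->
    normc (p.[x] - p.[x']) <= L * normc (x - x').
Proof.
elim/poly_ind: p => [|p c [L L0 IHL]].
  by exists 0 => // x x' _ _; rewrite !horner0 subrr ComplexField.Normc.normc0 mul0r.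
have [M M0 PM] := coef_bounded p.
pose K := M * \sum_(i < size p) 1 ^+ i.
have K0 : 0 <= K by rewrite mulr_ge0 ?(ltW M0) // sumr_ge0 // => i _; rewrite expr1n.
exists (L + K); first by rewrite addr_ge0.
move=> x x' x1 x'1; rewrite !hornerE.
have -> : p.[x] * x + c - (p.[x'] * x' + c) =
          (p.[x] - p.[x']) * x + p.[x'] * (x - x') by ring.
rewrite (le_trans (normcD _ _)) // !ComplexField.Normc.normcM mulrDl lerD //.
  by rewrite -[leRHS]mulr1 ler_pM ?normc_ge0 ?IHL.
by rewrite ler_wpM2r ?normc_ge0 //; exact: horner_close_bound.
Qed.

Definition pencil_path a b c d (s : R) : {poly C} := pencil k a b c d s%:C%C.

Lemma pencil_lipschitz a b c d : exists L : R, forall s s' : R,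
  0 <= s <= 1 -> 0 <= s' <= 1 ->
  coef_close (pencil_path a b c d s) (pencil_path a b c d s') (L * `|s - s'|).
Proof.
(* Here s is an indeterminate: each coefficient of the pencil is a polynomial in s, hence Lipschitz
   on [0, 1]. *)
pose G : {poly {poly C}} :=
  pencil k (polyC \o a) (polyC \o b) (polyC \o c) (polyC \o d) 'X.
have pathE s : pencil_path a b c d s = map_poly (horner_eval s%:C%C) G.
  rewrite map_pencil /= /horner_eval hornerX /pencil_path /pencil /pdiag /poff /=.
  congr (_ * _ - _ * _); rewrite ?hornerC; try congr (_ - _);
    by apply: eq_bigr => j _ /=; rewrite hornerC.
have [L PL] : exists L : R, forall s s' : R, 0 <= s <= 1 -> 0 <= s' <= 1 ->
    forall i, (i < size G)%N ->
    normc ((pencil_path a b c d s - pencil_path a b c d s')`_i) <= L * `|s - s'|.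
  elim: (size G) => [|m [L PL]]; first by exists 0.
  have [L' L'0 PL'] := lipschitz_horner G`_m.
  exists (Num.max L L') => s s' s01 s'01 i; rewrite ltnS leq_eqVlt => /orP[/eqP->|im].
    rewrite coefB !pathE !coef_map /= /horner_eval.
    apply: (@le_trans _ _ (L' * `|s - s'|)); last first.
      by rewrite ler_wpM2r // le_max lexx orbT.
    rewrite -[`|s - s'|]normc_real rmorphB; case/andP: s01 => ? ?; case/andP: s'01 => ? ?.
    by apply: PL'; rewrite normc_real ger0_norm.
  by rewrite (le_trans (PL _ _ s01 s'01 i im)) // ler_wpM2r // le_max lexx.
exists L => s s' s01 s'01 i; case: (ltnP i (size G)) => [|Gi]; first exact: PL.
rewrite coefB !pathE !coef_map /= !(nth_default 0 Gi) /horner_eval !horner0 subrr.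
(* The sign of L is not recorded; L |s - s'| >= 0 is read off the bound for coefficient 0, which
   exists because a monic pencil forces G to be nonzero. *)
rewrite ComplexField.Normc.normc0; case: (posnP (size G)) => [G0|G0].
  have [mon _] := pencil_monic k a b c d 0.
  have /negP[] := monic_neq0 mon; move/eqP: G0; rewrite size_poly_eq0 => /eqP G0.
  by have := pathE 0; rewrite G0 rmorph0 /pencil_path rmorph0 => ->.
by apply: le_trans (PL s s' s01 s'01 0%N G0); exact: normc_ge0.
Qed.

Definition diag_rad a : R := \sum_(j < k) normc (a j) / y ^+ (k - j).
Definition off_rad c : R := \sum_(j < k.+1) normc (c j) / y ^+ (k - j).
(** Off-diagonal column sum of the block companion matrix in the column of [a k], after a diagonal
    similarity that turns the identity blocks into y times the identity. *)
Definition col_rad a c : R := diag_rad a + off_rad c.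

Lemma diag_rad_ge0 a : 0 <= diag_rad a.
Proof. by rewrite sumr_ge0 // => j _; rewrite divr_ge0 ?normc_ge0 // exprn_ge0 // ltW. Qed.

Lemma off_rad_ge0 a : 0 <= off_rad a.
Proof. by rewrite sumr_ge0 // => j _; rewrite divr_ge0 ?normc_ge0 // exprn_ge0 // ltW. Qed.

Lemma col_rad_ge0 a c : 0 <= col_rad a c.
Proof. by rewrite addr_ge0 ?diag_rad_ge0 ?off_rad_ge0. Qed.

(** Isolate z^k (z - a_k) e; since s y <= |z|, each factor s^(k-j) is at most (|z|/y)^(k-j), and
    |z|^k cancels. Keeping |e| and |o| apart is what detects equality at a contact point. *)
Lemma column_bound a c s z e o :
    0 <= s -> z != 0 -> s * y <= normc z ->
    (pdiag k a s%:C%C).[z] * e = (poff k c s%:C%C).[z] * o ->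
  normc (z - a k) * normc e <= s * (diag_rad a * normc e + off_rad c * normc o).
Proof.
move=> s0 z0 syz; rewrite horner_pdiag horner_poff => eqn.
have nz : 0 < normc z by rewrite normc_gt0.
have eqn2 : z ^+ k * ((z - a k) * e) =
    (\sum_(j < k) s%:C%C ^+ (k.+1 - j) * a j * z ^+ j) * e
  + (\sum_(j < k.+1) s%:C%C ^+ (k.+1 - j) * c j * z ^+ j) * o.
  by rewrite -eqn exprS; ring.
have term (u : C) j : (j <= k)%N ->
    normc (s%:C%C ^+ (k.+1 - j) * u * z ^+ j) <=
    normc z ^+ k * (s * (normc u / y ^+ (k - j))).
  move=> jk; rewrite !ComplexField.Normc.normcM !normcX normc_real ger0_norm //.
  have -> : normc z ^+ k = normc z ^+ (k - j) * normc z ^+ j by rewrite -exprD subnK.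
  rewrite subSn // exprS.
  have yp : 0 < y ^+ (k - j) by rewrite exprn_gt0.
  have le : s ^+ (k - j) <= normc z ^+ (k - j) / y ^+ (k - j).
    rewrite ler_pdivlMr // -exprMn lerXn2r // ?nnegrE ?normc_ge0 //.
    by rewrite mulr_ge0 // ltW.
  have n0 : 0 <= s * normc u * normc z ^+ j.
    by rewrite !mulr_ge0 ?exprn_ge0 ?normc_ge0.
  have := ler_wpM2l n0 le; set S := s ^+ _; set T := _ ^+ (k - j) / _.
  have -> : s * S * normc u * normc z ^+ j = s * normc u * normc z ^+ j * S by ring.
  by move/le_trans; apply; rewrite /T le_eqVlt; apply/orP; left; apply/eqP; ring.
have sum_term (u : nat -> C) n : (n <= k.+1)%N ->
    normc (\sum_(j < n) s%:C%C ^+ (k.+1 - j) * u j * z ^+ j) <=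
    normc z ^+ k * (s * \sum_(j < n) normc (u j) / y ^+ (k - j)).
  move=> nk; rewrite (le_trans (normc_sum _ _ _)) // !mulr_sumr ler_sum // => j _.
  by apply: term; rewrite -ltnS (leq_trans (ltn_ord j)).
rewrite -(ler_pM2l (exprn_gt0 k nz)) -normcX -!ComplexField.Normc.normcM eqn2.
rewrite (le_trans (normcD _ _)) // !ComplexField.Normc.normcM normcX !mulrDr.
have assoc (p q r t : R) : p * (q * (r * t)) = p * (q * r) * t by ring.
by rewrite lerD // assoc ler_wpM2r ?normc_ge0 ?sum_term.
Qed.

Lemma pencil_null_vector a b c d s z : root (pencil_path a b c d s) z ->
  exists e o : C, [/\ (e != 0) || (o != 0),
    (pdiag k a s%:C%C).[z] * e = (poff k c s%:C%C).[z] * o &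
    (pdiag k d s%:C%C).[z] * o = (poff k b s%:C%C).[z] * e].
Proof.
rewrite /root hornerD hornerN !hornerM subr_eq0 => /eqP; exact: null_vector2.
Qed.

(** Outside the disc around 0, the null vector component of larger modulus decides which of the
    other two discs contains z. *)
Lemma pencil_location a b c d s z : 0 <= s -> root (pencil_path a b c d s) z ->
  [\/ normc z <= s * y, normc (z - a k) <= s * col_rad a c |
      normc (z - d k) <= s * col_rad d b].
Proof.
move=> s0 /pencil_null_vector[e [o [eo0 eqa eqd]]].
case: (leP (normc z) (s * y)) => [zsy|syz]; first by constructor 1.
have z0 : z != 0 by rewrite -normc_gt0 (le_lt_trans _ syz) // mulr_ge0 // ltW.
have aux a' c' (u v : C) : v != 0 \/ u != 0 -> normc v <= normc u ->
    (pdiag k a' s%:C%C).[z] * u = (poff k c' s%:C%C).[z] * v ->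
    normc (z - a' k) <= s * col_rad a' c'.
  move=> uv0 vu /(column_bound s0 z0 (ltW syz)) bnd.
  have u0 : 0 < normc u.
    by case: uv0; rewrite -normc_gt0 // => v0; exact: lt_le_trans vu.
  rewrite -(ler_pM2r u0) (le_trans bnd) // -mulrA ler_wpM2l // mulrDl lerD2l.
  by rewrite ler_wpM2l // off_rad_ge0.
case: (leP (normc o) (normc e)) => oe; [constructor 2|constructor 3].
  by apply: (aux a c e o) => //; case/orP: eo0; [right|left].
by apply: (aux d b o e) => //; [case/orP: eo0; [left|right]|exact: ltW].
Qed.

End PencilDiscs.

Lemma zeros_split_sub (R : realType) (zs : seq R[i]) k (P P' Q Q' : pred R[i]) :
  subpred P P' -> subpred Q Q' -> zeros_split zs k P Q -> zeros_split zs k P' Q'.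
Proof.
move=> PP QQ [zs1 [zs2 [zsE szk P1 Q2]]]; exists zs1, zs2.
by split; [| |exact: sub_all P1|exact: sub_all Q2].
Qed.

Lemma cdiscE (R : realType) (x : R[i]) (r : R) z : (z \in cdisc x r) = (normc (z - x) <= r).
Proof. by []. Qed.

Lemma cdisc_norm_ge (R : realType) (x : R[i]) (r : R) z :
  z \in cdisc x r -> normc x - r <= normc z.
Proof.
rewrite cdiscE normcB => zx; have := normcD (x - z) z; rewrite subrK; lra.
Qed.

Lemma cdisc_disjoint (R : realType) (x x' : R[i]) (r r' : R) z :
  r + r' < normc (x - x') -> z \in cdisc x r -> z \notin cdisc x' r'.
Proof.
move=> rr; rewrite !cdiscE -ltNge => zx.
have := normc_triangle x z x'; rewrite (normcB x z); lra.
Qed.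

(** * Counting the zeros of the pencil in groups of discs *)

Section PencilSplit.
Variables (R : realType) (k : nat) (y : R).
Hypothesis y0 : 0 < y.
Local Notation C := R[i].
Implicit Types (a b c d : nat -> C) (z w e o : C) (s : R) (sq zs : seq C).
Local Notation col_rad := (@col_rad R k y).

Lemma pencil_discs_split a b c d (ds1 ds2 : seq (C * R)) sq :
    perm_eq (ds1 ++ ds2) [:: (0, y); (a k, col_rad a c); (d k, col_rad d b)] ->
    (forall d1 d2 : C * R, d1 \in ds1 -> d2 \in ds2 ->
       d1.1 != d2.1 /\ d1.2 + d2.2 <= normc (d1.1 - d2.1)) ->
    pencil_path k a b c d 1 = \prod_(w <- sq) ('X - w%:P) ->
  zeros_split sq (count (fun w => w \in map fst ds1) (nseq (2 * k) 0 ++ [:: a k; d k]))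
    (in_discs ds1 1) (in_discs ds2 1).
Proof.
move=> dsE sep F1; have [L PL] := pencil_lipschitz k a b c d.
have ds0 x : x \in ds1 ++ ds2 -> 0 <= x.2.
  rewrite (perm_mem dsE) !inE => /or3P[] /eqP-> /=; rewrite ?col_rad_ge0 //; exact: ltW.
apply: (@discs_homotopy R (2 * k.+1) (pencil_path k a b c d) L _ PL) => //.
- by move=> s _; exact: pencil_monic.
- move=> s z /andP[s0 s1] /(pencil_location y0 s0) zloc.
  rewrite /in_discs (perm_has _ dsE) /= subr0 orbF.
  by case: zloc => ->; rewrite ?orbT.
- by rewrite /pencil_path rmorph0 pencil0.
- have mem u : (u \in map fst ds1 ++ map fst ds2) = (u \in [:: 0; a k; d k]).
    by rewrite -map_cat (perm_mem (perm_map fst dsE)).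
  by rewrite all_cat all_nseq /= !mem !inE !eqxx !orbT.
Qed.

Lemma pencil_split_two a b c d sq :
    y + col_rad a c <= normc (a k) -> y + col_rad d b <= normc (d k) ->
    pencil_path k a b c d 1 = \prod_(w <- sq) ('X - w%:P) ->
  zeros_split sq (2 * k) (fun z => z \in cdisc 0 y)
    (fun z => (z \in cdisc (a k) (col_rad a c)) || (z \in cdisc (d k) (col_rad d b))).
Proof.
move=> ya yd F1.
have pos (u : C) (r : R) : 0 <= r -> y + r <= normc u -> 0 != u.
  by move=> r0 yr; rewrite eq_sym -normc_gt0; have := y0; lra.
have a0 := pos _ _ (col_rad_ge0 k y0 a c) ya; have d0 := pos _ _ (col_rad_ge0 k y0 d b) yd.
have := @pencil_discs_split a b c d [:: (0, y)]
  [:: (a k, col_rad a c); (d k, col_rad d b)] sq (perm_refl _) _ F1.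
rewrite count_cat count_nseq /= !inE eqxx mul1n eq_sym (negPf a0) eq_sym (negPf d0) !addn0.
move=> H; apply: zeros_split_sub (H _).
- by move=> z; rewrite /in_discs /= cdiscE orbF mul1r.
- by move=> z; rewrite /in_discs /= !cdiscE orbF !mul1r.
- by move=> d1 d2; rewrite !inE => /eqP-> /orP[]/eqP->; rewrite /= sub0r normc_opp.
Qed.

(** The discs around 0 and [d k] form one group and may overlap; only the disc around [a k] has to
    be separated. *)
Lemma pencil_split_one a b c d sq :
    y + col_rad a c <= normc (a k) ->
    col_rad a c + col_rad d b < normc (a k - d k) ->
    pencil_path k a b c d 1 = \prod_(w <- sq) ('X - w%:P) ->
  zeros_split sq (2 * k).+1
    (fun z => (z \in cdisc 0 y) || (z \in cdisc (d k) (col_rad d b)))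
    (fun z => z \in cdisc (a k) (col_rad a c)).
Proof.
move=> ya ad F1; have ra := col_rad_ge0 k y0 a c; have rd := col_rad_ge0 k y0 d b.
have a0 : a k != 0 by rewrite -normc_gt0; have := y0; lra.
have da : a k != d k by rewrite -subr_eq0 -normc_gt0; lra.
have := @pencil_discs_split a b c d [:: (0, y); (d k, col_rad d b)]
  [:: (a k, col_rad a c)] sq _ _ F1.
rewrite count_cat count_nseq /= !inE eqxx mul1n (negPf a0) (negPf da) eqxx orbT addn0 addn1.
move=> H; apply: zeros_split_sub (H _ _).
- by move=> z; rewrite /in_discs /= !cdiscE orbF !mul1r.
- by move=> z; rewrite /in_discs /= !cdiscE orbF !mul1r.
- by rewrite perm_cons; exact: permEl (perm_catC [:: _] [:: _]).
- move=> d1 d2; rewrite !inE => /orP[]/eqP-> /eqP-> /=.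
    by rewrite sub0r normc_opp eq_sym.
  by rewrite eq_sym normcB addrC ltW.
Qed.

(* If z is in the disc around a k but not in the one around d k, the weight of
   a null vector at z sits on the first coordinate. *)
Lemma null_vector_dominant b d z e o :
    y <= normc z -> col_rad d b < normc (z - d k) -> (e != 0) || (o != 0) ->
    (pdiag k d 1).[z] * o = (poff k b 1).[z] * e ->
  normc o < normc e.
Proof.
move=> yz dz eo0 eqd; rewrite ltNge; apply/negP => eo.
have z0 : z != 0 by rewrite -normc_gt0 (lt_le_trans y0).
have o0 : 0 < normc o.
  by case/orP: eo0; rewrite -normc_gt0 // => e0; exact: lt_le_trans eo.
have := @column_bound R k y y0 d b 1 z o e ler01 z0.
rewrite !mul1r rmorph1 => /(_ yz eqd); apply/negP; rewrite -ltNge.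
apply: (@le_lt_trans _ _ (col_rad d b * normc o)); last by rewrite ltr_pM2r.
by rewrite mulrDl lerD2l ler_wpM2l // off_rad_ge0.
Qed.

End PencilSplit.

Lemma poly_ext_nonzero (F : closedFieldType) (p q : {poly F}) :
  (forall x, x != 0 -> p.[x] = q.[x]) -> p = q.
Proof.
move=> pq; apply/eqP; rewrite -subr_eq0; apply/negPn/negP => pq0.
(* The factor X forces the non-root x to be nonzero. *)
have /closed_nonrootP[x] : 'X * (p - q) != 0 by rewrite mulf_neq0 // polyX_eq0.
rewrite /root hornerM hornerX hornerD hornerN.
by case: (eqVneq x 0) => [->|/pq->]; rewrite ?mul0r ?subrr ?mulr0 eqxx.
Qed.

Lemma poly_ext (F : closedFieldType) (p q : {poly F}) :
  (forall x, p.[x] = q.[x]) -> p = q.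
Proof. by move=> pq; apply: poly_ext_nonzero => x _. Qed.

(* Compares the determinants of both sides of V L(z^2) = diag(q(z), q(-z)) V', where
   V has rows (1, z) S, (1, -z) S and V' has rows (1, z - t) S, (1, -z - t) S. *)
Lemma det2_quotient (F : numFieldType) (s00 s01 s10 s11 t z A B D E Q Q' : F) :
    s00 * s11 - s01 * s10 != 0 -> z != 0 ->
    A * (s00 + z * s10) - E * (s01 + z * s11) = Q * (s00 + (z - t) * s10) ->
    D * (s01 + z * s11) - B * (s00 + z * s10) = Q * (s01 + (z - t) * s11) ->
    A * (s00 + - z * s10) - E * (s01 + - z * s11) = Q' * (s00 + (- z - t) * s10) ->
    D * (s01 + - z * s11) - B * (s00 + - z * s10) = Q' * (s01 + (- z - t) * s11) ->
  A * D - B * E = Q * Q'.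
Proof.
move=> det z0 e1 e2 e3 e4.
(* V and V' both have determinant -2 z det S, which cancels. *)
apply: (mulfI det); apply: (mulfI z0); apply: (@mulfI _ 2); first by rewrite pnatr_eq0.
have : (A * (s00 + z * s10) - E * (s01 + z * s11)) *
       (D * (s01 + - z * s11) - B * (s00 + - z * s10)) -
       (D * (s01 + z * s11) - B * (s00 + z * s10)) *
       (A * (s00 + - z * s10) - E * (s01 + - z * s11)) =
       Q * (s00 + (z - t) * s10) * (Q' * (s01 + (- z - t) * s11)) -
       Q * (s01 + (z - t) * s11) * (Q' * (s00 + (- z - t) * s10)).
  by rewrite e1 e2 e3 e4.
move=> eqn; apply: oppr_inj; apply/eqP; rewrite -subr_eq0; apply/eqP.
move/eqP: eqn; rewrite -subr_eq0 => /eqP <-; ring.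
Qed.

(** * The squared zeros as zeros of the pencil *)

Section SquaredZeros.
Variables (R : realType) (k : nat).
Local Notation C := R[i].
Variables (zs : seq C).
Hypothesis szzs : size zs = (2 * k.+1)%N.
Local Notation q := (\prod_(z <- zs) ('X - z%:P)).

(* The row vector (1, z) S, with S = [[s00, s01], [s10, s11]], is a left null
   vector of X^(k+1) - sum_j F_j X^j at X = z^2 whenever q(z) = 0. *)
Definition pencil_of_zeros (a b c d : nat -> C) (s00 s01 s10 s11 t : C) :=
  [/\ s00 * s11 - s01 * s10 != 0,
      forall z, (pdiag k a 1).[z ^+ 2] * (s00 + z * s10) -
                (poff k c 1).[z ^+ 2] * (s01 + z * s11) = q.[z] * (s00 + (z - t) * s10) &
      forall z, (pdiag k d 1).[z ^+ 2] * (s01 + z * s11) -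
                (poff k b 1).[z ^+ 2] * (s00 + z * s10) = q.[z] * (s01 + (z - t) * s11)].

(** Exchanging the columns of S transfers results about the disc of [a k] to that of [d k]. *)
Lemma pencil_of_zeros_swap a b c d s00 s01 s10 s11 t :
  pencil_of_zeros a b c d s00 s01 s10 s11 t -> pencil_of_zeros d c b a s01 s00 s11 s10 t.
Proof. by case=> det H1 H2; split=> //; rewrite -opprB oppr_eq0. Qed.

(** The determinant at z^2 is q(z) q(-z), which is the product of the z^2 - w^2 because the number
    of zeros is even. Cancelling z restricts the comparison to nonzero arguments. *)
Lemma pencil_squares a b c d s00 s01 s10 s11 t :
    pencil_of_zeros a b c d s00 s01 s10 s11 t ->
  pencil_path k a b c d 1 = \prod_(w <- [seq z ^+ 2 | z <- zs]) ('X - w%:P).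
Proof.
case=> det H1 H2; apply: poly_ext_nonzero => x x0.
have [z xE] : exists z, x = z ^+ 2 by exists (sqrtC x); rewrite sqrtCK.
have z0 : z != 0 by apply: contraNneq x0 => z0; rewrite xE z0 expr0n.
have qq : (\prod_(w <- [seq z ^+ 2 | z <- zs]) ('X - w%:P)).[x] = q.[z] * q.[- z].
  rewrite !horner_prod big_map xE; transitivity (\prod_(w <- zs) ((z - w) * (z + w))).
    by apply: eq_bigr => w _; rewrite !hornerE; ring.
  rewrite big_split /=; congr (_ * _); first by apply: eq_bigr => w _; rewrite !hornerE.
  transitivity (\prod_(w <- zs) ((-1) * (- z - w))).
    by apply: eq_bigr => w _; ring.
  rewrite big_split /= big_const_seq count_predT szzs iter_mulr_1 exprM sqrrN !expr1n mul1r.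
  by apply: eq_bigr => w _; rewrite !hornerE.
rewrite qq /pencil_path rmorph1 /pencil hornerD hornerN !hornerM {qq}.
have := H1 z; have := H2 z; have := H1 (- z); have := H2 (- z); rewrite sqrrN -xE.
by move=> e4 e3 e2 e1; exact: det2_quotient det z0 e1 e2 e3 e4.
Qed.

End SquaredZeros.

(** * At most one zero with its square in a separated disc *)

Section CountDisc.
Variables (R : realType) (k : nat).
Local Notation C := R[i].
Variables (zs : seq C).
Hypothesis szzs : size zs = (2 * k.+1)%N.
Local Notation q := (\prod_(z <- zs) ('X - z%:P)).
Variable y : R.
Hypothesis y0 : 0 < y.
Local Notation col_rad := (@col_rad R k y).

Lemma count_first_disc a b c d s00 s01 s10 s11 t :
    pencil_of_zeros k zs a b c d s00 s01 s10 s11 t ->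
    y + col_rad a c <= normc (a k) ->
    col_rad a c + col_rad d b < normc (a k - d k) ->
  (count (fun z : C => (z ^+ 2)%R \in cdisc (a k) (col_rad a c)) zs <= 1)%N.
Proof.
move=> pz ya ad; set P := fun z => _.
have sqE := pencil_squares szzs pz; have [det H1 H2] := pz.
(* Without a square in both discs, the zeros counted by P all fail the first condition of
   [pencil_split_one], which allows only one such zero. *)
case: (boolP (has (fun z => P z && (z ^+ 2 \in cdisc 0 y)) zs)); last first.
  move=> /hasPn notouch; have := pencil_split_one y0 ya ad sqE.
  case/zeros_split_countP=> _ _; rewrite count_map size_map szzs => cnt.
  have {}cnt : (count (preim (fun z : C => (z ^+ 2)%R)
      (predC (fun z : C => (z \in cdisc 0%R y) || (z \in cdisc (d k) (col_rad d b))))) zs <= 1)%N.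
    by move: cnt; rewrite mulnS addnS -addSn leq_add2r.
  apply: leq_trans cnt; apply: sub_in_count => z zzs Pz /=.
  have := notouch z zzs; rewrite Pz /= => /negPf->.
  exact: cdisc_disjoint ad Pz.
move=> /hasP[z0 z0s /andP[Pz0 z0y]].
have nearP z : P z -> y <= normc (z ^+ 2).
  by move=> /cdisc_norm_ge; apply: le_trans; rewrite lerBrDr.
have rootq z : z \in zs -> q.[z] = 0.
  by move=> zzs; apply/eqP; rewrite -/(root q z) root_prod_XsubC.
have dom z e o : P z -> (e != 0) || (o != 0) ->
    (pdiag k d 1).[z ^+ 2] * o = (poff k b 1).[z ^+ 2] * e -> normc o < normc e.
  move=> Pz; apply: (null_vector_dominant y0 (nearP z Pz)).
  by rewrite ltNge; apply: cdisc_disjoint ad Pz.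
have nz z : (s00 + z * s10 != 0) || (s01 + z * s11 != 0).
  apply: contraNT det; rewrite negb_or !negbK => /andP[/eqP e00 /eqP e01].
  by rewrite (_ : _ - _ = (s00 + z * s10) * s11 - (s01 + z * s11) * s10);
    [rewrite e00 e01 !mul0r subrr | ring].
have eqD z : z \in zs ->
    (pdiag k d 1).[z ^+ 2] * (s01 + z * s11) = (poff k b 1).[z ^+ 2] * (s00 + z * s10).
  by move=> zzs; apply/eqP; rewrite -subr_eq0 H2 rootq // mul0r.
have eqA z : z \in zs ->
    (pdiag k a 1).[z ^+ 2] * (s00 + z * s10) = (poff k c 1).[z ^+ 2] * (s01 + z * s11).
  by move=> zzs; apply/eqP; rewrite -subr_eq0 H1 rootq // mul0r.
have nz0 z : P z -> z != 0.
  move=> /nearP; apply: contraTneq => ->.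
  by rewrite expr0n ComplexField.Normc.normc0 -ltNge.
have nege z : P z -> z \in zs -> - z \notin zs.
  move=> Pz zzs; apply/negP => nzzs; have eqDz := eqD z zzs; have eqDn := eqD _ nzzs.
  rewrite sqrrN in eqDn.
  (* If -z were also a zero, the null vectors for z and -z would combine to (0, x) with x = 2 z det
     S, against the dominance of the first coordinate. *)
  pose x := (s00 + - z * s10) * (s01 + z * s11) - (s00 + z * s10) * (s01 + - z * s11).
  have x0 : x != 0.
    rewrite (_ : x = 2 * z * (s00 * s11 - s01 * s10)); last by rewrite /x; ring.
    apply: mulf_neq0 => //; apply: mulf_neq0; [by rewrite pnatr_eq0 | exact: nz0].
  have /(dom z 0 x Pz) : ((0 : C) != 0) || (x != 0) by rewrite x0 orbT.
  rewrite ComplexField.Normc.normc0 ltNge normc_ge0 => dz; case/negP: isT; apply/negPn/dz.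
  rewrite mulr0 /x mulrBr mulrCA eqDz [in X in _ - X]mulrCA eqDn; ring.
(* At the contact point z0^2 is at distance at least the full radius from [a k]; since |o| < |e|,
   [column_bound] permits this only if the part weighted by |o| vanishes. *)
have off0 : off_rad k y c = 0.
  have := @column_bound R k y y0 a c 1 (z0 ^+ 2) _ _ ler01.
  rewrite rmorph1 !mul1r => /(_ _ _ _ (nearP _ Pz0) (eqA _ z0s)).
  have lt := dom z0 _ _ Pz0 (nz z0) (eqD z0 z0s).
  have z2 : z0 ^+ 2 != 0 by rewrite expf_neq0 // nz0.
  move=> /(_ z2) bnd; have oc := off_rad_ge0 k y0 c.
  have za : col_rad a c <= normc (z0 ^+ 2 - a k).
    have := normcD (a k - z0 ^+ 2) (z0 ^+ 2); rewrite subrK normcB.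
    by move: z0y; rewrite cdiscE subr0; lra.
  have := le_trans (ler_wpM2r (normc_ge0 (s00 + z0 * s10)) za) bnd.
  rewrite -[col_rad a c]/(diag_rad k y a + off_rad k y c) mulrDl mul1r lerD2l => le.
  apply/eqP; rewrite eq_le oc andbT leNgt; apply/negP => oc0.
  by move: le; rewrite ler_pM2l // leNgt lt.
have c0 : poff k c 1 = 0.
  apply: big1 => j _; have /psumr_eq0P/(_ j isT)/eqP := off0.
  rewrite mulf_eq0 invr_eq0 expf_eq0 [y == 0]gt_eqF // andbF orbF normc_eq0 => cj.
  rewrite (eqP (cj _)) ?mulr0 ?mul0r // => i _.
  by rewrite divr_ge0 ?normc_ge0 // exprn_ge0 // ltW.
pose G := pdiag k a 1; pose ep : {poly C} := s00%:P + 'X * s10%:P.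
pose kp : {poly C} := s00%:P + ('X - t%:P) * s10%:P.
have HG : (G \Po 'X^2) * ep = q * kp.
  apply: poly_ext => x; rewrite !hornerM horner_comp hornerXn.
  by have := H1 x; rewrite c0 horner0 mul0r subr0 /ep /kp !hornerE.
have epz z : P z -> z \in zs -> s00 + z * s10 != 0.
  move=> Pz zzs; rewrite -normc_gt0; apply: le_lt_trans (normc_ge0 _) _.
  exact: dom (nz z) (eqD z zzs).
have qn z : P z -> z \in zs -> q.[- z] != 0.
  by move=> Pz zzs; rewrite -/(root q (- z)) root_prod_XsubC nege.
(* As [ep] is nonzero at z, G(z^2) = 0; reading the factorization at -z, where q is nonzero, gives a
   zero of the linear [kp] there. *)
have kpz z : P z -> z \in zs -> s00 + (- z - t) * s10 = 0.
  move=> Pz zzs; have := H1 z; rewrite c0 horner0 mul0r subr0 rootq // mul0r.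
  move/eqP; rewrite mulf_eq0 (negPf (epz _ Pz zzs)) orbF => /eqP G0.
  have := H1 (- z); rewrite sqrrN G0 c0 horner0 !mul0r subr0 => /esym/eqP.
  by rewrite mulf_eq0 (negPf (qn _ Pz zzs)) => /eqP.
have s10N0 : s10 != 0.
  apply: contraNneq det => s10E; have := kpz z0 Pz0 z0s.
  by rewrite s10E !mulr0 addr0 => ->; rewrite mul0r subrr.
have Pz0E z : z \in zs -> P z -> z == z0.
  move=> zzs Pz; rewrite -subr_eq0 -(inj_eq (mulIf s10N0)) mul0r.
  have e1 := kpz z Pz zzs; have e2 := kpz z0 Pz0 z0s.
  rewrite (_ : _ * _ = s00 + (- z0 - t) * s10 - (s00 + (- z - t) * s10)); last by ring.
  by rewrite e1 e2 subrr.
apply: (@leq_trans (count_mem z0 zs)); first exact: sub_in_count.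
(* A multiple zero z0 would give G'(z0^2) = 0 on differentiating at z0; the derivative at -z0 then
   reads 0 = q(-z0) s10, a contradiction. *)
rewrite leqNgt; apply/negP => mult.
have z0s' : z0 \in rem z0 zs.
  move: mult; rewrite (permP (perm_to_rem z0s)) /= eqxx add1n ltnS.
  by rewrite -has_count has_pred1.
have qz' : q^`().[z0] = 0.
  rewrite (prodXsubC_rem z0s) derivM derivXsubC mul1r hornerD !hornerM.
  by rewrite hornerXsubC subrr mul0r addr0 (prodXsubC_rem z0s') hornerM hornerXsubC subrr mul0r.
have G0 : G.[z0 ^+ 2] = 0.
  have := H1 z0; rewrite c0 horner0 mul0r subr0 rootq // mul0r.
  by move/eqP; rewrite mulf_eq0 (negPf (epz _ Pz0 z0s)) orbF => /eqP.
have dHG := congr1 (fun p => p^`()) HG.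
rewrite /= !derivM deriv_comp derivXn in dHG.
have G'0 : G^`().[z0 ^+ 2] = 0.
  have := congr1 (fun p => p.[z0]) dHG.
  rewrite !hornerD !hornerM !horner_comp hornerMn !hornerXn G0 mul0r addr0.
  rewrite qz' rootq // !mul0r addr0 => /eqP.
  rewrite !mulf_eq0 mulrn_eq0 /= expr1 (negPf (nz0 _ Pz0)) orbF.
  rewrite (_ : ep.[z0] = s00 + z0 * s10) ?(negPf (epz _ Pz0 z0s)) ?orbF => [/eqP//|].
  by rewrite /ep !hornerE.
have := congr1 (fun p => p.[- z0]) dHG.
rewrite !hornerD !hornerM !horner_comp !hornerXn sqrrN G0 G'0 !mul0r addr0.
rewrite (_ : kp.[- z0] = 0) ?mulr0 ?add0r; last first.
  by rewrite -(kpz z0 Pz0 z0s) /kp !hornerE.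
move=> /esym/eqP; rewrite mulf_eq0 (negPf (qn _ Pz0 z0s)) /=.
rewrite /kp derivD derivC derivM derivXsubC derivC mulr0 addr0 add0r mul1r hornerC.
by rewrite (negPf s10N0).
Qed.

End CountDisc.

(** * Convexity of the radii *)

Section Convexity.
Variable R : realType.
Implicit Types (f g : R -> R) (x a b t : R).

Definition pos_convex f := forall a x b, 0 < a -> a <= x <= b ->
  (b - a) * f x <= (b - x) * f a + (x - a) * f b.

Lemma pos_convexD f g : pos_convex f -> pos_convex g -> pos_convex (fun x => f x + g x).
Proof.
by move=> cf cg a x b a0 axb; have := cf a x b a0 axb; have := cg a x b a0 axb; lra.
Qed.

Lemma pos_convexMl t f : 0 <= t -> pos_convex f -> pos_convex (fun x => t * f x).
Proof.
move=> t0 cf a x b a0 axb; have := ler_wpM2l t0 (cf a x b a0 axb).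
by rewrite mulrDr !(mulrCA t).
Qed.

Lemma pos_convex_sum (I : Type) (s : seq I) (F : I -> R -> R) :
  (forall i, pos_convex (F i)) -> pos_convex (fun x => \sum_(i <- s) F i x).
Proof.
move=> cF a x b a0 axb; rewrite !mulr_sumr -big_split ler_sum // => i _.
exact: cF.
Qed.

Lemma pos_convex_cst t : pos_convex (fun=> t).
Proof. by move=> a x b _ _; rewrite -subr_ge0 (_ : _ - _ = 0) //; ring. Qed.

Lemma pos_convex_id : pos_convex id.
Proof. by move=> a x b _ _ /=; rewrite -subr_ge0 (_ : _ - _ = 0) //; ring. Qed.

Lemma pos_convex_sqr : pos_convex (fun x => x ^+ 2).
Proof.
move=> a x b a0 /andP[ax xb]; rewrite -subr_ge0.
rewrite (_ : _ - _ = (b - x) * (x - a) * (b - a)); last by ring.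
by rewrite !mulr_ge0 // subr_ge0 // (le_trans ax).
Qed.

(** Induction: the hypothesis times 1/x leaves the slack (b - x)(x - a)(A b - B a)/(a b x),
    nonnegative because A = a^(-n) >= B = b^(-n). *)
Lemma pos_convex_exprV n : pos_convex (fun x => (x ^+ n)^-1).
Proof.
elim: n => [|n IHn]; first by move=> a x b _ _; rewrite !expr0 -subr_ge0 (_ : _ - _ = 0) //; ring.
move=> a x b a0 axb; have /andP[ax xb] := axb.
have x0 : 0 < x := lt_le_trans a0 ax; have b0 : 0 < b := lt_le_trans x0 xb.
have := IHn a x b a0 axb; rewrite !exprS !invfM.
set A := (a ^+ n)^-1; set X := (x ^+ n)^-1; set B := (b ^+ n)^-1 => IH.
have AB : B <= A.
  rewrite lef_pV2 ?posrE ?exprn_gt0 //.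
  by apply: lerXn2r (le_trans ax xb); rewrite nnegrE ltW.
have B0 : 0 < B by rewrite invr_gt0 exprn_gt0.
have x'0 : 0 < x^-1 by rewrite invr_gt0.
rewrite mulrCA mulrC; apply: le_trans (ler_wpM2r (ltW x'0) IH) _.
rewrite -subr_ge0.
have -> : (b - x) * (a^-1 * A) + (x - a) * (b^-1 * B) - ((b - x) * A + (x - a) * B) / x
   = (b - x) * (x - a) * (A * b - B * a) / (a * b * x).
  by field; rewrite !gt_eqF.
apply: divr_ge0; last by rewrite !mulr_ge0 ?ltW.
apply: mulr_ge0; first by rewrite mulr_ge0 // subr_ge0.
by rewrite subr_ge0; apply: ler_pM (le_trans ax xb) => //; exact: ltW.
Qed.

Lemma pos_convex_term t n : 0 <= t -> pos_convex (fun x => t / x ^+ n).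
Proof. by move=> t0; apply: pos_convexMl t0 (@pos_convex_exprV n). Qed.

(** Both ends solve g = c, and a convex function lies below its chord. Equal ends are treated apart
    because t2 - t1 is cancelled. *)
Lemma pos_solutions_le f g c t1 t2 x :
    (forall u, 0 < u -> f u = 0 <-> g u = c) -> pos_convex g ->
    pos_solutions f t1 t2 -> t1 <= x <= t2 -> g x <= c.
Proof.
move=> fg cg [t10 t12 ft] /andP[t1x xt2].
have t20 : 0 < t2 := lt_le_trans t10 t12.
have g1 : g t1 = c by apply/fg => //; apply/ft => //; left.
have g2 : g t2 = c by apply/fg => //; apply/ft => //; right.
case: (eqVneq t1 t2) => [t12E|t12N].
  by rewrite (_ : x = t1) ?g1 //; apply/eqP; rewrite eq_le t1x t12E xt2.
have := cg t1 x t2 t10; rewrite t1x xt2 g1 g2 => /(_ isT).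
rewrite -mulrDl (_ : t2 - x + (x - t1) = t2 - t1); last by ring.
by rewrite ler_pM2l // subr_gt0 lt_neqAle t12N.
Qed.

Lemma pos_solutions_inter f f' t1 t2 u1 u2 :
    pos_solutions f t1 t2 -> pos_solutions f' u1 u2 ->
    (sol_interval f `&` sol_interval f' !=set0)%classic ->
  Num.max t1 u1 <= Num.min t2 u2.
Proof.
have uniq h a b a' b' : pos_solutions h a b -> pos_solutions h a' b' -> a = a' /\ b = b'.
  move=> [a0 ab ha] [a'0 ab' ha'].
  have b0 := lt_le_trans a0 ab; have b'0 := lt_le_trans a'0 ab'.
  have e1 := (ha' a a0).1 ((ha a a0).2 (or_introl erefl)).
  have e2 := (ha' b b0).1 ((ha b b0).2 (or_intror erefl)).
  have e3 := (ha a' a'0).1 ((ha' a' a'0).2 (or_introl erefl)).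
  have e4 := (ha b' b'0).1 ((ha' b' b'0).2 (or_intror erefl)).
  by split; case: e1; case: e2; case: e3; case: e4; lra.
move=> ft fu [x [[a [b [fab axb]]] [a' [b' [fab' axb']]]]].
have [<- <-] := uniq _ _ _ _ _ fab ft; have [<- <-] := uniq _ _ _ _ _ fab' fu.
case/andP: axb => ax xb; case/andP: axb' => ax' xb'.
by apply: (@le_trans _ _ x); rewrite ?ge_max ?le_min ?ax ?ax' ?xb ?xb'.
Qed.

End Convexity.

(** * The equations chi and omega as sums of radii *)

Section Radii.
Variable R : realType.
Implicit Types (v w : nat -> R[i]) (alpha beta gamma : R[i]) (x : R).

Lemma big_pairs (V : nmodType) k (F : nat -> V) :
  \sum_(i < 2 * k) F i = \sum_(j < k) (F (2 * j)%N + F (2 * j).+1).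
Proof.
elim: k => [|k IHk]; first by rewrite !big_ord0.
by rewrite mulnS addnC addn2 !big_ord_recr /= IHk -addrA.
Qed.

Lemma chi1_eq0 k v alpha x : 0 < x -> chi1 (2 * k.+1) v alpha x = 0 <->
  x ^+ 2 + rho1 (2 * k.+1) v x = normc alpha.
Proof.
move=> x0; have xu (j : nat) : x ^+ j != 0 by rewrite expf_neq0 ?gt_eqF.
have -> : chi1 (2 * k.+1) v alpha x =
    x ^+ (2 * k.+1 - 2) * (x ^+ 2 + rho1 (2 * k.+1) v x - normc alpha).
  rewrite /chi1 /rho1 mulrBr mulrDr -exprD subnK; last by rewrite mulnS leq_addr.
  rewrite addrAC [_ * normc alpha]mulrC; congr (_ + _ - _).
  rewrite mulr_sumr; apply: eq_bigr => j _.
  rewrite mulrCA; congr (_ * _); rewrite -[X in x ^+ X / _](subnK (ltnW (ltn_ord j))).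
  by rewrite exprD mulrAC divff ?mul1r.
split=> [/eqP|->]; last by rewrite subrr mulr0.
by rewrite mulf_eq0 (negPf (xu _)) /= subr_eq0 => /eqP.
Qed.

Lemma chi2_eq0 k w beta gamma x : 0 < x -> chi2 (2 * k.+1) w beta gamma x = 0 <->
  x ^+ 2 + rho2 (2 * k.+1) w gamma x = normc beta.
Proof.
move=> x0; have xu (j : nat) : x ^+ j != 0 by rewrite expf_neq0 ?gt_eqF.
have n1 : (2 * k.+1 - 1 = (2 * k.+1 - 2).+1)%N by rewrite mulnS; lia.
have -> : chi2 (2 * k.+1) w beta gamma x =
    x ^+ (2 * k.+1 - 1) * (x ^+ 2 + rho2 (2 * k.+1) w gamma x - normc beta).
  rewrite /chi2 /rho2 mulrBr !mulrDr -exprD.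
  have -> : (2 * k.+1 - 1 + 2)%N = (2 * k.+1).+1 by rewrite mulnS; lia.
  have -> : x ^+ (2 * k.+1 - 1) * (normc gamma / x) = normc gamma * x ^+ (2 * k.+1 - 2).
    by rewrite n1 exprSr; field; rewrite gt_eqF.
  have -> : x ^+ (2 * k.+1 - 1) * (\sum_(j < 2 * k.+1 - 2) normc (w j) / x ^+ (2 * k.+1 - 1 - j))
      = \sum_(j < 2 * k.+1 - 2) normc (w j) * x ^+ j.
    rewrite mulr_sumr; apply: eq_bigr => j _.
    have jn : (j <= 2 * k.+1 - 1)%N by rewrite n1 leqW // ltnW.
    rewrite mulrCA; congr (_ * _); rewrite -[X in x ^+ X / _](subnK jn).
    by rewrite exprD mulrAC divff ?mul1r.
  by ring.
split=> [/eqP|->]; last by rewrite subrr mulr0.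
by rewrite mulf_eq0 (negPf (xu _)) /= subr_eq0 => /eqP.
Qed.

Lemma omega_sum k (F : nat -> R) x : 0 < x ->
  x ^+ k * (\sum_(j < k) F j / x ^+ (k - j)) = \sum_(j < k) F j * x ^+ j.
Proof.
move=> x0; rewrite mulr_sumr; apply: eq_bigr => j _.
rewrite mulrCA; congr (_ * _); rewrite -[X in x ^+ X / _](subnK (ltnW (ltn_ord j))).
by rewrite exprD mulrAC divff ?mul1r // expf_neq0 ?gt_eqF.
Qed.

Lemma omega1_eq0 k v alpha x : 0 < x -> omega1 k.+1 v alpha x = 0 <->
  x + sigma1 k.+1 v x = normc alpha.
Proof.
move=> x0; have xu : x ^+ k != 0 by rewrite expf_neq0 ?gt_eqF.
have -> : omega1 k.+1 v alpha x = x ^+ k * (x + sigma1 k.+1 v x - normc alpha).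
  rewrite /omega1 /sigma1 subn1 /= mulrBr mulrDr.
  rewrite (omega_sum k (fun j => normc (v (2 * j).+1) + normc (v (2 * j)%N)) x0) exprSr; ring.
split=> [/eqP|->]; last by rewrite subrr mulr0.
by rewrite mulf_eq0 (negPf xu) /= subr_eq0 => /eqP.
Qed.

Lemma omega2_eq0 k w beta gamma x : 0 < x -> omega2 k.+1 w beta gamma x = 0 <->
  x + sigma2 k.+1 w gamma x = normc beta.
Proof.
move=> x0; have xu : x ^+ k != 0 by rewrite expf_neq0 ?gt_eqF.
have -> : omega2 k.+1 w beta gamma x = x ^+ k * (x + sigma2 k.+1 w gamma x - normc beta).
  rewrite /omega2 /sigma2 subn1 /= mulrBr !mulrDr.
  rewrite (omega_sum k (fun j => normc (w (2 * j).+1) + normc (w (2 * j)%N)) x0) exprSr; ring.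
split=> [/eqP|->]; last by rewrite subrr mulr0.
by rewrite mulf_eq0 (negPf xu) /= subr_eq0 => /eqP.
Qed.

Lemma rho1_convex n v : pos_convex (fun x => x ^+ 2 + rho1 n v x).
Proof.
apply: pos_convexD (@pos_convex_sqr R) _; apply: pos_convex_sum => i.
exact: pos_convex_term (normc_ge0 _).
Qed.

Lemma rho2_convex n w gamma : pos_convex (fun x => x ^+ 2 + rho2 n w gamma x).
Proof.
apply: pos_convexD (@pos_convex_sqr R) (pos_convexD _ _).
  exact: (@pos_convex_term R _ 1 (normc_ge0 _)).
by apply: pos_convex_sum => i; apply: pos_convex_term; exact: normc_ge0.
Qed.

Lemma sigma1_convex m v : pos_convex (fun x => x + sigma1 m v x).
Proof.
apply: pos_convexD (@pos_convex_id R) _; apply: pos_convex_sum => i.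
by apply: pos_convex_term; rewrite addr_ge0 ?normc_ge0.
Qed.

Lemma sigma2_convex m w gamma : pos_convex (fun x => x + sigma2 m w gamma x).
Proof.
apply: pos_convexD (@pos_convex_id R) (pos_convexD _ _).
  exact: pos_convex_cst.
by apply: pos_convex_sum => i; apply: pos_convex_term; rewrite addr_ge0 ?normc_ge0.
Qed.

End Radii.

(** * The matrix polynomial of p *)

Section Encoding.
Variables (R : realType) (l k : nat) (p : {poly R[i]}) (zs : seq R[i]) (S : 'M[R[i]]_2).
Local Notation C := R[i].
Hypothesis lk : half_deg l = k.+1.
Hypothesis p_monic : p \is monic.
Hypothesis p_deg : size p = l.+1.
Hypothesis hzs : p = \prod_(z <- zs) ('X - z%:P).
Hypothesis S_unit : S \in unitmx.
Implicit Types (z : C).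

Definition padded_zeros := if odd l then 0 :: zs else zs.

Lemma size_zeros : size zs = l.
Proof. by apply: succn_inj; rewrite -p_deg hzs size_prod_XsubC. Qed.

Lemma double_half_deg : (2 * k.+1 = odd l + l)%N.
Proof. by rewrite -lk /half_deg mul2n uphalfK. Qed.

Lemma size_padded_zeros : size padded_zeros = (2 * k.+1)%N.
Proof.
by rewrite double_half_deg /padded_zeros; case: (odd l); rewrite /= size_zeros.
Qed.

(** The convention a_(-1) = 0 lets A_0 follow the formula of the other A_j. *)
Definition shift_coef (i : nat) : C := if i is i'.+1 then acoef l p i' else 0.

Lemma horner_padded z :
  (\prod_(w <- padded_zeros) ('X - w%:P)).[z] =
  z ^+ (2 * k.+1) + \sum_(i < 2 * k.+1) acoef l p i * z ^+ i.
Proof.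
have pl : p`_l = 1 by have := monicP p_monic; rewrite lead_coefE p_deg.
have pE : p.[z] = z ^+ l + \sum_(i < l) p`_i * z ^+ i.
  by rewrite horner_coef p_deg big_ord_recr /= pl mul1r addrC.
rewrite double_half_deg /padded_zeros /acoef; case: (odd l); last by rewrite -hzs pE.
rewrite big_cons -hzs subr0 hornerM hornerX pE add1n big_ord_recl /= mul0r add0r.
rewrite mulrDr -exprS mulr_sumr; congr (_ + _); apply: eq_bigr => i _.
by rewrite exprS mulrCA.
Qed.

Let t : C := acoef l p (2 * half_deg l - 1).

Lemma Amx_entries j :
  [/\ Amx l p j 0 0 = - acoef l p (2 * j), Amx l p j 1 0 = - acoef l p (2 * j).+1,
      Amx l p j 0 1 = t * acoef l p (2 * j) - shift_coef (2 * j) &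
      Amx l p j 1 1 = t * acoef l p (2 * j).+1 - acoef l p (2 * j)].
Proof.
rewrite /Amx -/t; case: j => [|j]; first by rewrite !mxE /=; split=> //; rewrite subr0.
have -> : shift_coef (2 * j.+1) = acoef l p (2 * j.+1 - 1) by rewrite mulnS.
by rewrite !mxE.
Qed.

Let F j : 'M[C]_2 := invmx S *m Amx l p j *m S.

Lemma row_through_S z j i :
  (S 0 0 + z * S 1 0) * F j 0 i + (S 0 1 + z * S 1 1) * F j 1 i =
  (Amx l p j 0 0 + z * Amx l p j 1 0) * S 0 i +
  (Amx l p j 0 1 + z * Amx l p j 1 1) * S 1 i.
Proof.
have SF : S *m F j = Amx l p j *m S by rewrite /F !mulmxA mulmxV // mul1mx.
move: (F j) (Amx l p j) SF => G A SF.
have entry (h : 'I_2) : S h 0 * G 0 i + S h 1 * G 1 i = A h 0 * S 0 i + A h 1 * S 1 i.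
  have := congr1 (fun M : 'M_2 => M h i) SF; rewrite !mxE !big_ord_recl !big_ord0.
  have -> : lift ord0 ord0 = 1 :> 'I_2 by apply: val_inj.
  by rewrite !addr0.
transitivity (S 0 0 * G 0 i + S 0 1 * G 1 i + z * (S 1 0 * G 0 i + S 1 1 * G 1 i)).
  by ring.
rewrite !entry; ring.
Qed.

(** Without S this is the identity behind the choice of the A_j: (1, z) (z^n - sum_j z^(2j) A_j) =
    q(z) (1, z - t) with t = a_(n-1) and n = 2(k+1). *)
Lemma sum_rows z i :
  \sum_(j < k.+1) (z ^+ 2) ^+ j * ((S 0 0 + z * S 1 0) * F j 0 i + (S 0 1 + z * S 1 1) * F j 1 i)
  = (z ^+ 2) ^+ k.+1 * (S 0 i + z * S 1 i)
    - (\prod_(w <- padded_zeros) ('X - w%:P)).[z] * (S 0 i + (z - t) * S 1 i).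
Proof.
rewrite horner_padded.
set Q := \sum_(i < 2 * k.+1) acoef l p i * z ^+ i.
have QE : Q = _ := big_pairs k.+1 (fun i => acoef l p i * z ^+ i).
have sum0 : \sum_(j < k.+1) (z ^+ 2) ^+ j * (Amx l p j 0 0 + z * Amx l p j 1 0) = - Q.
  rewrite QE -sumrN; apply: eq_bigr => j _.
  by have [-> -> _ _] := Amx_entries j; rewrite -exprM exprS; ring.
(* Shifting the index multiplies by z and pushes out the top term t z^n. *)
have sumE : \sum_(i < 2 * k.+1) shift_coef i * z ^+ i = z * Q - t * z ^+ (2 * k.+1).
  rewrite /Q /t lk mulnS /= big_ord_recl /= mul0r add0r [in RHS]big_ord_recr /=.
  rewrite subn1 /= mulrDr mulrCA -exprS addrK mulr_sumr; apply: eq_bigr => j _.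
  by rewrite exprS mulrCA.
have sum1 : \sum_(j < k.+1) (z ^+ 2) ^+ j * (Amx l p j 0 1 + z * Amx l p j 1 1) =
    t * Q - (z * Q - t * z ^+ (2 * k.+1)).
  have aE := big_pairs k.+1 (fun i => shift_coef i * z ^+ i).
  rewrite -sumE aE QE mulr_sumr -sumrB; apply: eq_bigr => j _.
  by have [_ _ -> ->] := Amx_entries j; rewrite -exprM exprS /=; ring.
under eq_bigr do rewrite row_through_S mulrDr !mulrA.
rewrite big_split /= -!mulr_suml sum0 sum1 -exprM; ring.
Qed.

Lemma pencil_of_padded_zeros :
  pencil_of_zeros k padded_zeros (fun j => F j 0 0) (fun j => F j 0 1)
    (fun j => F j 1 0) (fun j => F j 1 1) (S 0 0) (S 0 1) (S 1 0) (S 1 1) t.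
Proof.
have det : S 0 0 * S 1 1 - S 0 1 * S 1 0 != 0.
  have := S_unit; rewrite unitmxE unitfE; apply: contraNneq => det0; apply/eqP.
  rewrite (expand_det_row _ 0) !big_ord_recl big_ord0 /cofactor !det_mx11 !mxE /=.
  have -> : lift (0 : 'I_2) 0 = 1 by apply: val_inj.
  have -> : lift (1 : 'I_2) 0 = 0 by apply: val_inj.
  rewrite addr0; apply: etrans det0; rewrite /= addn0 /bump /= expr0 expr1; ring.
have split_sum (f g : nat -> C) (x u v : C) :
    (pdiag k f 1).[x] * u - (poff k g 1).[x] * v =
    x ^+ k.+1 * u - \sum_(j < k.+1) x ^+ j * (u * f j + v * g j).
  rewrite horner_pdiag horner_poff.
  have -> : \sum_(j < k.+1) x ^+ j * (u * f j + v * g j) =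
      (\sum_(j < k.+1) f j * x ^+ j) * u + (\sum_(j < k.+1) g j * x ^+ j) * v.
    by rewrite !mulr_suml -big_split /=; apply: eq_bigr => j _; ring.
  under eq_bigr do rewrite expr1n mul1r.
  under [X in _ - X * v = _]eq_bigr do rewrite expr1n mul1r.
  by rewrite [X in _ = _ - (X * _ + _)]big_ord_recr /=; ring.
split=> // z; first by rewrite split_sum sum_rows; ring.
have sumE := sum_rows z 1; rewrite split_sum.
rewrite (eq_bigr (fun j : 'I_k.+1 => (z ^+ 2) ^+ j *
    ((S 0 0 + z * S 1 0) * F j 0 1 + (S 0 1 + z * S 1 1) * F j 1 1))).
  by rewrite sumE; ring.
by move=> j _; rewrite addrC.
Qed.

End Encoding.

(** Replaces S by S diag(1, 1/h); part (a) uses it with h = x. *)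
Lemma pencil_of_zeros_scale (R : realType) k (zs : seq R[i]) a b c d s00 s01 s10 s11 t h :
    h != 0 -> pencil_of_zeros k zs a b c d s00 s01 s10 s11 t ->
  pencil_of_zeros k zs a (fun j => b j / h) (fun j => c j * h) d
    s00 (s01 / h) s10 (s11 / h) t.
Proof.
move=> h0 [det H1 H2].
have offE (e : nat -> R[i]) (g x : R[i]) :
    (poff k (fun j => e j * g) 1).[x] = (poff k e 1).[x] * g.
  by rewrite !horner_poff mulr_suml; apply: eq_bigr => j _; ring.
split.
- rewrite (_ : _ - _ = (s00 * s11 - s01 * s10) / h); last by field.
  by rewrite mulf_neq0 // invr_eq0.
- by move=> z; rewrite offE -H1; field.
- move=> z; rewrite (_ : s01 / h + (z - t) * (s11 / h) = (s01 + (z - t) * s11) / h);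
    last by field.
  by rewrite [RHS]mulrA -H2 offE; field.
Qed.

(** * Location of the squared zeros *)

Lemma count_geC (T : Type) (Q : pred T) (s : seq T) j :
  (j <= size s -> count (predC Q) s <= size s - j -> j <= count Q s)%N.
Proof.
by have := count_predC Q s; move: (count Q s) (count _ s) (size s) => *; lia.
Qed.

Lemma zeros_split_map (R : realType) (f : R[i] -> R[i]) (zs : seq R[i]) k P Q :
  zeros_split [seq f z | z <- zs] k P Q ->
  zeros_split zs k (fun z => P (f z)) (fun z => Q (f z)).
Proof. by rewrite !zeros_split_countP all_map !count_map size_map. Qed.

Lemma zeros_split_behead (R : realType) (x : R[i]) (zs : seq R[i]) k (P Q : pred R[i]) :
  ~~ Q x -> zeros_split (x :: zs) k.+1 P Q -> zeros_split zs k P Q.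
Proof.
move=> Qx; rewrite !zeros_split_countP /= (negPf Qx) /= orbF.
by case=> /andP[-> allPQ]; rewrite !add0n add1n addnS !ltnS; split.
Qed.

Section Location.
Variable R : realType.
Local Notation C := R[i].
Implicit Types (zs : seq C) (alpha beta z : C) (y ra rb : R).

(** The localization at one fixed parameter, with bare radii so that (a) and (b) share it. The exact
    counts are listed because a split alone gives only a lower bound. *)
Definition squares_located zs alpha beta y ra rb : Prop :=
  [/\ y + ra <= normc alpha -> y + rb <= normc beta ->
        zeros_split zs (size zs - 2) (fun z => z ^+ 2 \in cdisc 0 y)
          (fun z => (z ^+ 2 \in cdisc alpha ra) || (z ^+ 2 \in cdisc beta rb)),
      y + ra <= normc alpha -> ra + rb < normc (alpha - beta) ->
        zeros_split zs (size zs - 1)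
          (fun z => (z ^+ 2 \in cdisc 0 y) || (z ^+ 2 \in cdisc beta rb))
          (fun z => z ^+ 2 \in cdisc alpha ra) /\
        count (fun z => z ^+ 2 \in cdisc alpha ra) zs = 1%N &
      y + rb <= normc beta -> ra + rb < normc (alpha - beta) ->
        zeros_split zs (size zs - 1)
          (fun z => (z ^+ 2 \in cdisc 0 y) || (z ^+ 2 \in cdisc alpha ra))
          (fun z => z ^+ 2 \in cdisc beta rb) /\
        count (fun z => z ^+ 2 \in cdisc beta rb) zs = 1%N].

Lemma pencil_squares_located k zs a b c d s00 s01 s10 s11 t y :
    size zs = (2 * k.+1)%N -> 0 < y ->
    pencil_of_zeros k zs a b c d s00 s01 s10 s11 t ->
  squares_located zs (a k) (d k) y (col_rad k y a c) (col_rad k y d b).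
Proof.
move=> szzs y0 pz.
have one a' b' c' d' s00' s01' s10' s11' :
    pencil_of_zeros k zs a' b' c' d' s00' s01' s10' s11' t ->
    y + col_rad k y a' c' <= normc (a' k) ->
    col_rad k y a' c' + col_rad k y d' b' < normc (a' k - d' k) ->
    zeros_split zs (size zs - 1)
      (fun z => (z ^+ 2 \in cdisc 0 y) || (z ^+ 2 \in cdisc (d' k) (col_rad k y d' b')))
      (fun z => z ^+ 2 \in cdisc (a' k) (col_rad k y a' c')) /\
    count (fun z => z ^+ 2 \in cdisc (a' k) (col_rad k y a' c')) zs = 1%N.
  move=> pz' ya ad; have := pencil_split_one y0 ya ad (pencil_squares szzs pz').
  move/zeros_split_map; rewrite (_ : (2 * k).+1 = size zs - 1)%N; last first.
    by rewrite szzs mulnS; lia.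
  move=> spl; split=> //; apply/eqP.
  rewrite eqn_leq (count_first_disc szzs y0 pz' ya ad) /=.
  have /zeros_split_countP[_ cQ _] := spl.
  by apply: count_geC cQ; rewrite szzs.
split; last 2 first.
- exact: one pz.
- by move=> yd ad; apply: (one _ _ _ _ _ _ _ _ (pencil_of_zeros_swap pz)) => //;
    rewrite addrC normcB.
move=> ya yd; have := pencil_split_two y0 ya yd (pencil_squares szzs pz).
by move/zeros_split_map; rewrite (_ : 2 * k = size zs - 2)%N // szzs mulnS; lia.
Qed.

(** Since y > 0, the condition y + r <= |u| keeps the padding zero out of the disc around u. *)
Lemma squares_located_behead zs alpha beta y ra rb :
    (2 <= size zs)%N -> 0 < y ->
  squares_located (0 :: zs) alpha beta y ra rb -> squares_located zs alpha beta y ra rb.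
Proof.
move=> sz2 y0; have out (u : C) (r : R) : y + r <= normc u -> (0 : C) ^+ 2 \notin cdisc u r.
  by move=> yr; apply/negP => /cdisc_norm_ge; rewrite expr0n ComplexField.Normc.normc0; lra.
have sub1 : (size (0%R :: zs) - 1 = (size zs - 1).+1)%N.
  by rewrite /= subn1 -subSn ?subn1 // ltnW.
have sub2 : (size (0%R :: zs) - 2 = (size zs - 2).+1)%N by rewrite /= subSn.
move=> [H1 H2 H3]; split.
- move=> ya yb; have := H1 ya yb; rewrite sub2; apply: zeros_split_behead.
  by rewrite negb_or !out.
- move=> ya ab; have := H2 ya ab; rewrite sub1 /= (negPf (out _ _ ya)).
  by case=> spl cnt; split=> //; apply: zeros_split_behead spl; exact: out.
- move=> yb ab; have := H3 yb ab; rewrite sub1 /= (negPf (out _ _ yb)).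
  by case=> spl cnt; split=> //; apply: zeros_split_behead spl; exact: out.
Qed.

(** For y1 < y2 the outer discs avoid the inner disc of radius y1; they hold at least two squares,
    while at most two lie outside that disc, so these are the same zeros. *)
Lemma squares_located_two_radii zs alpha beta y1 ra1 rb1 y2 ra2 rb2 :
    (2 <= size zs)%N -> y1 = y2 \/ y1 < y2 ->
    squares_located zs alpha beta y1 ra1 rb1 -> squares_located zs alpha beta y2 ra2 rb2 ->
    y1 + ra1 <= normc alpha -> y1 + rb1 <= normc beta ->
    y2 + ra2 <= normc alpha -> y2 + rb2 <= normc beta ->
  zeros_split zs (size zs - 2) (fun z => z ^+ 2 \in cdisc 0 y1)
    (fun z => (z ^+ 2 \in cdisc alpha ra2) || (z ^+ 2 \in cdisc beta rb2)).
Proof.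
move=> sz2 y12 [loc1 _ _] [loc2 _ _] ya1 yb1 ya2 yb2.
have := loc2 ya2 yb2; case: y12 => [-> //|y12] /zeros_split_countP[_ cQ _].
have /zeros_split_countP[_ _ cP] := loc1 ya1 yb1.
pose E := predC (fun z : C => z ^+ 2 \in cdisc 0 y1).
pose U := fun z : C => (z ^+ 2 \in cdisc alpha ra2) || (z ^+ 2 \in cdisc beta rb2).
have UE : subpred U E.
  move=> z /orP[] /cdisc_norm_ge zge; rewrite /E /= cdiscE subr0 -ltNge; lra.
have cE : (count E zs <= 2)%N.
  by move: cP; rewrite -{2}(subnKC sz2) leq_add2r.
have cU : (2 <= count U zs)%N.
  exact: count_geC cQ.
apply/zeros_split_countP; split => //.
have c0 : count (predC U) (filter E zs) = 0%N.
  apply/eqP; rewrite -(eqn_add2l (count U (filter E zs))) count_predC size_filter addn0.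
  rewrite count_filter (@eq_count _ (predI U E) U); last first.
    move=> z; rewrite /= -/(U z); have := UE z; rewrite /E /=.
    by case: (U z) => [->|_].
  by rewrite eqn_leq (sub_count UE) (leq_trans cE cU).
apply/allP => z zzs /=; case: (boolP (z ^+ 2 \in cdisc 0 y1)) => //= Ez.
apply: contra_eqT c0 => Uz; rewrite -lt0n -has_count; apply/hasP.
by exists z => //; rewrite mem_filter zzs andbT.
Qed.

(** Common form of both parts: [y] is the inner radius for squares and [N] the one for zeros, namely
    x^2 and x in (a), x and its square root in (b). *)
Lemma zeros_location zs alpha beta (y N g1 g2 f1 f2 : R -> R) :
    (2 <= size zs)%N ->
    (forall x x' : R, 0 < x -> x < x' -> y x < y x') ->
    (forall x z, 0 < x -> (z \in cdisc 0 (N x)) = (z ^+ 2 \in cdisc 0 (y x))) ->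
    (forall x, 0 < x -> squares_located zs alpha beta (y x) (g1 x) (g2 x)) ->
    (forall t1 t2 x, pos_solutions f1 t1 t2 -> t1 <= x <= t2 -> y x + g1 x <= normc alpha) ->
    (forall t1 t2 x, pos_solutions f2 t1 t2 -> t1 <= x <= t2 -> y x + g2 x <= normc beta) ->
  ((sol_interval f1 `&` sol_interval f2 !=set0)%classic ->
     forall t1 t2 u1 u2 : R, pos_solutions f1 t1 t2 -> pos_solutions f2 u1 u2 ->
     let mu1 := Num.max t1 u1 in
     let mu2 := Num.min t2 u2 in
     [/\ zeros_split zs (size zs - 2)
           (fun z => z \in cdisc 0 (N mu1))
           (fun z => (z ^+ 2 \in cdisc alpha (g1 mu2)) || (z ^+ 2 \in cdisc beta (g2 mu2))),
         (forall z, root (\prod_(w <- zs) ('X - w%:P)) z ->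
           ~ (N mu1 < normc z <
              Num.sqrt (Num.min (normc alpha - g1 mu2) (normc beta - g2 mu2)))) &
         (g1 mu2 + g2 mu2 < normc (alpha - beta) ->
           count (fun z => z ^+ 2 \in cdisc alpha (g1 mu2)) zs = 1%N /\
           count (fun z => z ^+ 2 \in cdisc beta (g2 mu2)) zs = 1%N)]) /\
  ((forall t1 t2 : R, pos_solutions f1 t1 t2 ->
        g1 t2 + g2 t2 < normc (alpha - beta) ->
        zeros_split zs (size zs - 1)
          (fun z => (z ^+ 2 \in cdisc 0 (y t2)) || (z ^+ 2 \in cdisc beta (g2 t2)))
          (fun z => z ^+ 2 \in cdisc alpha (g1 t2))) /\
   (forall u1 u2 : R, pos_solutions f2 u1 u2 ->
        g1 u2 + g2 u2 < normc (alpha - beta) ->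
        zeros_split zs (size zs - 1)
          (fun z => (z ^+ 2 \in cdisc 0 (y u2)) || (z ^+ 2 \in cdisc alpha (g1 u2)))
          (fun z => z ^+ 2 \in cdisc beta (g2 u2)))).
Proof.
move=> sz2 ymono Ny loc le1 le2; split; last first.
  split=> [t1 t2 ft ab|u1 u2 fu ab].
    have [t10 t12 _] := ft; have [_ H _] := loc t2 (lt_le_trans t10 t12).
    by case: (H _ ab) => //; apply: le1 ft _; rewrite t12 lexx.
  have [u10 u12 _] := fu; have [_ _ H] := loc u2 (lt_le_trans u10 u12).
  by case: (H _ ab) => //; apply: le2 fu _; rewrite u12 lexx.
move=> inter t1 t2 u1 u2 ft fu mu1 mu2.
have mu12 : mu1 <= mu2 := pos_solutions_inter ft fu inter.
have [t10 _ _] := ft; have [u10 _ _] := fu.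
have mu10 : 0 < mu1 by rewrite lt_max t10.
have mu20 : 0 < mu2 := lt_le_trans mu10 mu12.
have [t1mu u1mu] : t1 <= mu1 /\ u1 <= mu1 by rewrite !le_max !lexx orbT.
have [mut2 muu2] : mu2 <= t2 /\ mu2 <= u2 by rewrite !ge_min !lexx orbT.
have a1 : y mu1 + g1 mu1 <= normc alpha.
  by apply: le1 ft _; rewrite t1mu (le_trans mu12).
have b1 : y mu1 + g2 mu1 <= normc beta.
  by apply: le2 fu _; rewrite u1mu (le_trans mu12).
have a2 : y mu2 + g1 mu2 <= normc alpha.
  by apply: le1 ft _; rewrite mut2 (le_trans t1mu).
have b2 : y mu2 + g2 mu2 <= normc beta.
  by apply: le2 fu _; rewrite muu2 (le_trans u1mu).
have y12 : y mu1 = y mu2 \/ y mu1 < y mu2.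
  by move: mu12; rewrite le_eqVlt => /orP[/eqP->|/(ymono _ _ mu10)]; [left|right].
have spl := squares_located_two_radii sz2 y12 (loc _ mu10) (loc _ mu20) a1 b1 a2 b2.
split.
- by apply: zeros_split_sub spl => // z; rewrite Ny.
- move=> z; rewrite root_prod_XsubC => zzs /andP[zmu zlt].
  have zout : z ^+ 2 \notin cdisc 0 (y mu1).
    by rewrite -Ny // cdiscE subr0 -ltNge.
  have z2 : normc (z ^+ 2) < Num.min (normc alpha - g1 mu2) (normc beta - g2 mu2).
    (* [Num.sqrt] is 0 on negative numbers; exceeding a modulus makes it positive, hence also the
       minimum. *)
    have m0 : 0 < Num.min (normc alpha - g1 mu2) (normc beta - g2 mu2).
      by rewrite -sqrtr_gt0; apply: le_lt_trans zlt; exact: normc_ge0.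
    rewrite normcX -(sqr_sqrtr (ltW m0)) ltrXn2r ?nnegrE ?normc_ge0 ?sqrtr_ge0 //.
  have /zeros_split_countP[/allP/(_ z zzs)/= zU _ _] := spl.
  move: zU z2; rewrite (negPf zout) lt_min /= => zU /andP[za zb].
  by case/orP: zU => /cdisc_norm_ge; lra.
- move=> ab; have [_ H2 H3] := loc _ mu20.
  by have [_ ->] := H2 a2 ab; have [_ ->] := H3 b2 ab.
Qed.

End Location.

Section RadiiTranslation.
Variables (R : realType) (k : nat).
Implicit Types (v w a b c d : nat -> R[i]) (x : R).

Lemma col_radE y a c :
  col_rad k y a c = normc (c k) + \sum_(j < k) (normc (c j) + normc (a j)) / y ^+ (k - j).
Proof.
rewrite /col_rad /off_rad big_ord_recr /= subnn expr0 divr1 addrA addrC; congr (_ + _).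
by rewrite /diag_rad -big_split; apply: eq_bigr => j _; rewrite /= addrC -mulrDl.
Qed.

Lemma sigma1_col_rad v a c y :
    (forall j, v (2 * j)%N = a j) -> (forall j, v (2 * j).+1 = c j) -> c k = 0 ->
  sigma1 k.+1 v y = col_rad k y a c.
Proof.
move=> va vc ck; rewrite col_radE ck ComplexField.Normc.normc0 add0r /sigma1 subn1 /=.
by apply: eq_bigr => j _; rewrite va vc.
Qed.

Lemma sigma2_col_rad w b d y :
    (forall j, w (2 * j)%N = b j) -> (forall j, w (2 * j).+1 = d j) ->
  sigma2 k.+1 w (b k) y = col_rad k y d b.
Proof.
move=> wb wd; rewrite col_radE /sigma2 subn1 /=; congr (_ + _).
by apply: eq_bigr => j _; rewrite wb wd addrC.
Qed.

(** The extra factor x turns the weight of v_(2j+1) into x / x^(2(k-j)) = 1 / x^(2k-(2j+1)), so both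
    parities fit the exponents of rho_1. *)
Lemma rho1_col_rad v a c x : 0 < x ->
    (forall j, v (2 * j)%N = a j) -> (forall j, v (2 * j).+1 = c j) -> c k = 0 ->
  rho1 (2 * k.+1) v x = col_rad k (x ^+ 2) a (fun j => c j * x%:C%C).
Proof.
move=> x0 va vc ck; rewrite col_radE ck mul0r ComplexField.Normc.normc0 add0r /rho1.
have -> : (2 * k.+1 - 2 = 2 * k)%N by rewrite mulnS addKn.
rewrite (big_pairs k (fun i => normc (v i) / x ^+ (2 * k - i))).
apply: eq_bigr => j _; rewrite va vc ComplexField.Normc.normcM normc_real gtr0_norm //.
have jk := ltn_ord j.
rewrite -exprM mulnBr -(@subnSK (2 * j) (2 * k)) ?ltn_pmul2l // exprS.
by field; rewrite expf_neq0 gt_eqF.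
Qed.

Lemma rho2_col_rad w b d x : 0 < x ->
    (forall j, w (2 * j)%N = b j) -> (forall j, w (2 * j).+1 = d j) ->
  rho2 (2 * k.+1) w (b k) x = col_rad k (x ^+ 2) d (fun j => b j / x%:C%C).
Proof.
have bx (u : R[i]) (t : R) : 0 < t -> normc (u / t%:C%C) = normc u / t.
  move=> t0; rewrite ComplexField.Normc.normcM ComplexField.Normc.normcV normc_real.
  by rewrite gtr0_norm.
move=> x0 wb wd; rewrite col_radE bx // /rho2; congr (_ + _).
have -> : (2 * k.+1 - 2 = 2 * k)%N by rewrite mulnS addKn.
have -> : (2 * k.+1 - 1 = (2 * k).+1)%N by rewrite mulnS addSn subn1.
rewrite (big_pairs k (fun i => normc (w i) / x ^+ ((2 * k).+1 - i))).
apply: eq_bigr => j _; rewrite wb wd bx // subSS -exprM mulnBr.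
rewrite subSn ?leq_pmul2l // ?(ltnW (ltn_ord j)) // exprS.
by field; rewrite expf_neq0 gt_eqF.
Qed.

End RadiiTranslation.

Theorem theorem4p1 (R : realType) (l : nat) (p : {poly R[i]})
    (zs : seq R[i]) (S : 'M[R[i]]_2) (alpha beta gamma : R[i])
    (hl : (3 <= l)%N) (p_monic : p \is monic) (p_deg : size p = l.+1)
    (hzs : p = \prod_(z <- zs) ('X - z%:P))
    (hS : S \in unitmx)
    (hA : invmx S *m Amx l p (half_deg l - 1) *m S = mx22 alpha gamma 0 beta) :
  let m := half_deg l in
  let n := (2 * m)%N in
  let v := vvec l p S in
  let w := wvec l p S in
  let r1 := rho1 n v in
  let r2 := rho2 n w gamma in
  let X1 := chi1 n v alpha in
  let X2 := chi2 n w beta gamma in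
  let s1 := sigma1 m v in
  let s2 := sigma2 m w gamma in
  let W1 := omega1 m v alpha in
  let W2 := omega2 m w beta gamma in
  let O1 (x : R) := cdisc 0 (x ^+ 2) in
  let O2 (x : R) := cdisc alpha (r1 x) in
  let O3 (x : R) := cdisc beta (r2 x) in
  let O1' (x : R) := cdisc 0 x in
  let O2' (x : R) := cdisc alpha (s1 x) in
  let O3' (x : R) := cdisc beta (s2 x) in
  let I1 := sol_interval X1 in
  let I2 := sol_interval X2 in
  let J1 := sol_interval W1 in
  let J2 := sol_interval W2 in
  ((I1 `&` I2 !=set0)%classic ->
     forall t1 t2 u1 u2 : R,
     pos_solutions X1 t1 t2 -> pos_solutions X2 u1 u2 ->
     let mu1 := Num.max t1 u1 in
     let mu2 := Num.min t2 u2 in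
     [/\ zeros_split zs (l - 2)
           (fun z => z \in cdisc 0 mu1)
           (fun z => (z ^+ 2 \in O2 mu2) || (z ^+ 2 \in O3 mu2)),
         (forall z : R[i], root p z ->
           ~ (mu1 < normc z <
              Num.sqrt (Num.min (normc alpha - r1 mu2)
                                (normc beta - r2 mu2)))) &
         (r1 mu2 + r2 mu2 < normc (alpha - beta) ->
           count (fun z => z ^+ 2 \in O2 mu2) zs = 1%N /\
           count (fun z => z ^+ 2 \in O3 mu2) zs = 1%N)]) /\
  ((I1 `&` I2 = set0)%classic ->
     (forall t1 t2 : R, pos_solutions X1 t1 t2 ->
        r1 t2 + r2 t2 < normc (alpha - beta) ->
        zeros_split zs (l - 1)
          (fun z => (z ^+ 2 \in O1 t2) || (z ^+ 2 \in O3 t2))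
          (fun z => z ^+ 2 \in O2 t2)) /\
     (forall u1 u2 : R, pos_solutions X2 u1 u2 ->
        r1 u2 + r2 u2 < normc (alpha - beta) ->
        zeros_split zs (l - 1)
          (fun z => (z ^+ 2 \in O1 u2) || (z ^+ 2 \in O2 u2))
          (fun z => z ^+ 2 \in O3 u2))) /\
  ((J1 `&` J2 !=set0)%classic ->
     forall t1 t2 u1 u2 : R,
     pos_solutions W1 t1 t2 -> pos_solutions W2 u1 u2 ->
     let mu1 := Num.max t1 u1 in
     let mu2 := Num.min t2 u2 in
     [/\ zeros_split zs (l - 2)
           (fun z => z \in cdisc 0 (Num.sqrt mu1))
           (fun z => (z ^+ 2 \in O2' mu2) || (z ^+ 2 \in O3' mu2)),
         (forall z : R[i], root p z ->
           ~ (Num.sqrt mu1 < normc z <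
              Num.sqrt (Num.min (normc alpha - s1 mu2)
                                (normc beta - s2 mu2)))) &
         (s1 mu2 + s2 mu2 < normc (alpha - beta) ->
           count (fun z => z ^+ 2 \in O2' mu2) zs = 1%N /\
           count (fun z => z ^+ 2 \in O3' mu2) zs = 1%N)]) /\
  ((J1 `&` J2 = set0)%classic ->
     (forall t1 t2 : R, pos_solutions W1 t1 t2 ->
        s1 t2 + s2 t2 < normc (alpha - beta) ->
        zeros_split zs (l - 1)
          (fun z => (z ^+ 2 \in O1' t2) || (z ^+ 2 \in O3' t2))
          (fun z => z ^+ 2 \in O2' t2)) /\
     (forall u1 u2 : R, pos_solutions W2 u1 u2 ->
        s1 u2 + s2 u2 < normc (alpha - beta) ->
        zeros_split zs (l - 1)
          (fun z => (z ^+ 2 \in O1' u2) || (z ^+ 2 \in O2' u2))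
          (fun z => z ^+ 2 \in O3' u2))).
Proof.
move=> m n v w r1 r2 X1 X2 s1 s2 W1 W2 O1 O2 O3 O1' O2' O3' I1 I2 J1 J2.
have [k lk] : exists k, half_deg l = k.+1.
  by exists (half_deg l).-1; rewrite prednK // /half_deg uphalf_gt0 (leq_trans _ hl).
have szz := size_zeros p_deg hzs.
have sz2 : (2 <= size zs)%N by rewrite szz ltnW.
pose F j : 'M[R[i]]_2 := invmx S *m Amx l p j *m S.
pose a j := F j 0 0; pose b j := F j 0 1; pose c j := F j 1 0; pose d j := F j 1 1.
have Fk : F k = mx22 alpha gamma 0 beta by rewrite /F -hA lk subn1.
have [ak bk ck dk] : [/\ a k = alpha, b k = gamma, c k = 0 & d k = beta].
  by rewrite /a /b /c /d Fk !mxE.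
have va j : v (2 * j)%N = a j.
  by rewrite /v /vvec /stacked_col mul2n odd_double doubleK.
have vc j : v (2 * j).+1 = c j.
  by rewrite /v /vvec /stacked_col mul2n /= odd_double uphalf_double.
have wb j : w (2 * j)%N = b j.
  by rewrite /w /wvec /stacked_col mul2n odd_double doubleK.
have wd j : w (2 * j).+1 = d j.
  by rewrite /w /wvec /stacked_col mul2n /= odd_double uphalf_double.
have pz := pencil_of_padded_zeros lk p_monic p_deg hzs hS.
rewrite -/F in pz.
have located (y ra rb : R) : 0 < y ->
    squares_located (padded_zeros l zs) alpha beta y ra rb ->
    squares_located zs alpha beta y ra rb.
  rewrite /padded_zeros; case: (odd l) => // y0.
  exact: squares_located_behead.
have szp := size_padded_zeros lk p_deg hzs.
(* For (a) the second column of S is divided by x and y is x^2; [locB] keeps S and takes y = x. *)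
have locA (x : R) : 0 < x -> squares_located zs alpha beta (x ^+ 2) (r1 x) (r2 x).
  move=> x0; have y0 : 0 < x ^+ 2 by rewrite exprn_gt0.
  apply: located => //; rewrite /r1 /r2 /n /m lk (rho1_col_rad x0 va vc ck).
  rewrite -bk (rho2_col_rad k x0 wb wd) -{1}ak -{1}dk.
  have x0' : x%:C%C != 0 by rewrite -normc_gt0 normc_real normr_gt0 gt_eqF.
  exact: (pencil_squares_located szp y0 (pencil_of_zeros_scale x0' pz)).
have locB (x : R) : 0 < x -> squares_located zs alpha beta x (s1 x) (s2 x).
  move=> x0; apply: located => //; rewrite /s1 /s2 /m lk (sigma1_col_rad x va vc ck).
  rewrite -bk (sigma2_col_rad k x wb wd) -{1}ak -{1}dk.
  exact: (pencil_squares_located szp x0 pz).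
have sqr_in (x : R) (z : R[i]) : 0 < x -> (z \in cdisc 0 x) = (z ^+ 2 \in cdisc 0 (x ^+ 2)).
  move=> x0; rewrite !cdiscE !subr0 normcX.
  by rewrite ler_pXn2r // nnegrE ?normc_ge0 // ltW.
have sqrt_in (x : R) (z : R[i]) : 0 < x -> (z \in cdisc 0 (Num.sqrt x)) = (z ^+ 2 \in cdisc 0 x).
  by move=> x0; rewrite sqr_in ?sqrtr_gt0 // sqr_sqrtr // ltW.
have sqr_mono (x x' : R) : 0 < x -> x < x' -> x ^+ 2 < x' ^+ 2.
  by move=> x0 xx'; rewrite ltrXn2r // ltW.
have leX1 t1 t2 x : pos_solutions X1 t1 t2 -> t1 <= x <= t2 -> x ^+ 2 + r1 x <= normc alpha.
  apply: pos_solutions_le (@rho1_convex R n v) => u u0.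
  by rewrite /X1 /n /m lk; exact: chi1_eq0.
have leX2 t1 t2 x : pos_solutions X2 t1 t2 -> t1 <= x <= t2 -> x ^+ 2 + r2 x <= normc beta.
  apply: pos_solutions_le (@rho2_convex R n w gamma) => u u0.
  by rewrite /X2 /n /m lk; exact: chi2_eq0.
have leW1 t1 t2 x : pos_solutions W1 t1 t2 -> t1 <= x <= t2 -> x + s1 x <= normc alpha.
  apply: pos_solutions_le (@sigma1_convex R m v) => u u0.
  by rewrite /W1 /m lk; exact: omega1_eq0.
have leW2 t1 t2 x : pos_solutions W2 t1 t2 -> t1 <= x <= t2 -> x + s2 x <= normc beta.
  apply: pos_solutions_le (@sigma2_convex R m w gamma) => u u0.
  by rewrite /W2 /m lk; exact: omega2_eq0.
have [A1 A2] := zeros_location (N := id) sz2 sqr_mono sqr_in locA leX1 leX2.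
have [B1 B2] := zeros_location (y := id) sz2 (fun x x' _ xx' => xx') sqrt_in locB leW1 leW2.
rewrite -hzs szz in A1 A2 B1 B2.
by split; [exact: A1 | split; [move=> _; exact: A2 | split; [exact: B1 | move=> _; exact: B2]]].
Qed.
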